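(* The only torsion-free, finitely generated nilpotent groups with positive deficiency are $\mathbb{Z}$ and $\mathbb{Z}^2$. That is, a torsion-free, finitely generated nilpotent group $G$ has positive deficiency if and only if $G\cong\mathbb{Z}$ or $G\cong\mathbb{Z}^2$.
   Context: A group $G$ has positive deficiency if it has a finite presentation with strictly more generators than relations. *)

(* Defs.v *)
From HB Require Import structures.
From mathcomp Require Import all_boot all_algebra.

Set Implicit Arguments.
Unset Strict Implicit.
Unset Printing Implicit Defensive.

Import GRing.Theory.
Local Open Scope group_scope.

(* Groups are arbitrary, possibly infinite, [groupType]s; subsets and subgroups
   of [G] are predicates [G -> Prop], since they need not be decidable. *)

Section Subgroups.
Variable G : groupType.
Implicit Types (A : G -> Prop) (x y : G).

Inductive generated A : G -> Prop :=
| generated_in x : A x -> generated A x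
| generated_1 : generated A 1
| generated_M x y : generated A x -> generated A y -> generated A (x * y)
| generated_V x : generated A x -> generated A x^-1.

Definition normal_closure A : G -> Prop :=
  generated (fun x => exists a g, A a /\ x = a ^ g).

Fixpoint lower_central_series (c : nat) : G -> Prop :=
  if c is c'.+1 then
    generated (fun z => exists x y, lower_central_series c' x /\ z = [~ x, y])
  else fun=> True.

End Subgroups.

Definition nilpotent_group (G : groupType) : Prop :=
  exists c, forall x : G, lower_central_series c x -> x = 1.

Definition finitely_generated (G : groupType) : Prop :=
  exists s : seq G, forall x : G, generated (fun y => y \in s) x.

Definition torsion_free (G : groupType) : Prop :=
  forall (x : G) (n : nat), 0 < n -> x ^+ n = 1 -> x = 1.

(* The free group on X, realized as reduced words: the letter (x, b) stands for
   x if b = false and for x^-1 if b = true. *)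
Section FreeGroup.
Variable X : choiceType.
Notation letter := (X * bool)%type.
Implicit Types (a b : letter) (u v w : seq letter).

Definition letter_inv a : letter := (a.1, ~~ a.2).
Definition reduced w := sorted (fun a b => b != letter_inv a) w.

(* Left multiplication of a reduced word by a letter. *)
Definition word_cons a w :=
  if w is b :: w' then if b == letter_inv a then w' else a :: w else [:: a].
Definition word_mul u v := foldr word_cons v u.
Definition word_inv w := rev (map letter_inv w).

Record free_group := FreeGroup { word :> seq letter; _ : reduced word }.
HB.instance Definition _ := [isSub for word].
HB.instance Definition _ := [Choice of free_group by <:].

Lemma letter_invK : involutive letter_inv.
Proof. by case=> x b; rewrite /letter_inv /= negbK. Qed.

Lemma letter_invC a b : (b == letter_inv a) = (a == letter_inv b).
Proof. by rewrite eq_sym (can2_eq letter_invK letter_invK). Qed.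

Lemma reduced_cons a w : reduced w -> reduced (word_cons a w).
Proof.
case: w => //= b w; case: eqP => [_|/eqP nba] pw; first exact: path_sorted pw.
by rewrite /reduced /= nba.
Qed.

Lemma reduced_mul u v : reduced v -> reduced (word_mul u v).
Proof. by move=> rv; elim: u => //= a u; apply: reduced_cons. Qed.

Lemma reduced_inv w : reduced w -> reduced (word_inv w).
Proof.
rewrite /reduced /word_inv rev_sorted sorted_map.
apply: sub_sorted => a b /=; apply: contra => /eqP.
by move=> /(can_inj letter_invK) ->; rewrite letter_invK.
Qed.

Lemma word_consK a w : reduced w -> word_cons (letter_inv a) (word_cons a w) = w.
Proof.
case: w => [|b w] /=; first by rewrite letter_invK eqxx.
rewrite /reduced /=; case: eqP => [->|_] /=; last by rewrite letter_invK eqxx.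
by case: w => //= c w /andP[/negPf-> _].
Qed.

Lemma word_mul_cons a u v :
  reduced v -> word_mul (word_cons a u) v = word_cons a (word_mul u v).
Proof.
case: u => //= b u rv; case: eqP => //= ->.
by rewrite -{1}[a]letter_invK word_consK // reduced_mul.
Qed.

Lemma word_mulA u v w :
  reduced w -> word_mul u (word_mul v w) = word_mul (word_mul u v) w.
Proof. by move=> rw; elim: u => //= a u ->; rewrite word_mul_cons. Qed.

Lemma word_mulw0 w : reduced w -> word_mul w [::] = w.
Proof.
elim: w => //= a w IHw paw; rewrite IHw; last exact: path_sorted paw.
by case: w paw {IHw} => //= b w /andP[/negPf-> _].
Qed.

Lemma word_mulVw w : reduced w -> word_mul (word_inv w) w = [::].
Proof.
rewrite /word_inv; elim: w => //= a w IHw paw.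
rewrite rev_cons /word_mul foldr_rcons /= letter_invK eqxx.
by apply: IHw; apply: path_sorted paw.
Qed.

Lemma word_invK : involutive word_inv.
Proof. by move=> w; rewrite /word_inv map_rev revK (mapK letter_invK). Qed.

Definition free_one : free_group := @FreeGroup [::] isT.
Definition free_mul (x y : free_group) : free_group :=
  FreeGroup (reduced_mul x (valP y)).
Definition free_inv (x : free_group) : free_group :=
  FreeGroup (reduced_inv (valP x)).

Lemma free_mulA : associative free_mul.
Proof. by move=> x y z; apply/val_inj/word_mulA/(valP z). Qed.
Lemma free_mul1g : left_id free_one free_mul.
Proof. by move=> x; apply/val_inj. Qed.
Lemma free_mulg1 : right_id free_one free_mul.
Proof. by move=> x; apply/val_inj/word_mulw0/(valP x). Qed.
Lemma free_mulVg : left_inverse free_one free_inv free_mul.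
Proof. by move=> x; apply/val_inj/word_mulVw/(valP x). Qed.
Lemma free_mulgV : right_inverse free_one free_inv free_mul.
Proof.
move=> x; rewrite -{1}[x](_ : free_inv (free_inv x) = x) ?free_mulVg //.
exact/val_inj/word_invK.
Qed.

HB.instance Definition _ := isGroup.Build free_group
  free_mulA free_mul1g free_mulg1 free_mulVg free_mulgV.

End FreeGroup.

(* phi exhibits G as the group with generators x_0, ..., x_(n-1) and relators
   rels: by the first isomorphism theorem it induces an isomorphism from the
   quotient of the free group by the normal closure of rels onto G. *)
Definition is_presentation (G : groupType) (n : nat)
    (rels : seq (free_group 'I_n)) (phi : {multiplicative free_group 'I_n -> G}) :=
  (forall g, exists w, phi w = g) /\
  (forall w, phi w = 1 <-> normal_closure (fun r => r \in rels) w).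

Definition positive_deficiency (G : groupType) : Prop :=
  exists (n : nat) (rels : seq (free_group 'I_n))
         (phi : {multiplicative free_group 'I_n -> G}),
    is_presentation rels phi /\ size rels < n.

Definition isomorphic (G H : groupType) : Prop :=
  exists f : {multiplicative G -> H}, bijective f.

(* The additive group of the integers, in multiplicative notation. *)
Definition Zgroup : Type := int.
HB.instance Definition _ := Choice.on Zgroup.
HB.instance Definition _ := isGroup.Build Zgroup
  (@addrA int) (@add0r int) (@addr0 int) (@addNr int) (@addrN int).

(* Main.v *)
(* For a presentation of G with n generators and m < n relators, let P_c be the
   space of rational polynomial functions of degree < c on G, of dimension b_c.
   Taking differences along the generators identifies P_(c+1), modulo constants,
   with the tuples in P_c^n killed by the Fox derivatives of the relators. If
   the exponent matrix has rank e, then d = n - e is the first Betti number, and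
   the m - e < d relators that can be recombined to have zero exponent sums
   lower degrees by one; hence b_(c+1) > d b_c - (d - 1) b_(c-1), a
   Golod-Shafarevich inequality. On the other hand b_c grows polynomially,
   because a finitely generated nilpotent group is a product of finitely many
   cyclic subgroups. This forces d <= 2, and b_3 <= 6 if d = 2. Finally let N be
   the kernel of the projection of G onto Z^d. If N were nontrivial it would
   have a nonzero G-invariant homomorphism to the rationals, which extends to a
   polynomial function on G giving b_2 >= 3 if d = 1 and b_3 >= 7 if d = 2. *)
From HB Require Import structures.
Require Import Defs.
From mathcomp Require Import all_boot all_algebra.
From mathcomp Require Import boolp classical_sets functions.
From mathcomp Require Import zify lra.

Set Implicit Arguments.
Unset Strict Implicit.
Unset Printing Implicit Defensive.

Import GRing.Theory.
Local Open Scope ring_scope.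

(** * Finite-dimensional subspaces over the rationals *)

Section FiniteDimension.

(** All functions on [G] form an infinite-dimensional space, so a subspace is a predicate and its
    dimension is witnessed by a linear parametrization. The bound b_3 <= 6 for d = 2 comes from d
    b_2 = 2 * 3 = 6. If b_3 exceeded it, the relators with zero exponent sums would impose no
    further condition on tuples of degree less than 2, hence would lower all degrees by two; then
    b_(c+1) > 2 b_c - b_(c-2), against polynomial growth. For d = 1 the equality b_2 = 2 suffices.
    The homomorphism on N exists because torsion in N / [N, G] would pass to all later factors of
    the series [N, G, ..., G], which reaches 1. Its extension to G is quadratic because the defect
    of additivity is its value at a commutator of powers y^b and x^a, which is additive in a. *)

Definition has_dim (V : lmodType rat) (P : V -> Prop) (d : nat) :=
  exists phi : {linear 'rV[rat]_d -> V},
    injective phi /\ forall v, P v <-> exists c, v = phi c.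

Lemma linear_pack (V W : lmodType rat) (T : V -> W) :
  linear T -> exists F : {linear V -> W}, F =1 T.
Proof.
move=> linT.
pose L := GRing.isLinear.Build rat V W _ T linT.
pose F : {linear V -> W} := HB.pack T L.
by exists F.
Qed.

Lemma rV0_eq (u v : 'rV[rat]_0) : u = v.
Proof. by apply/rowP=> -[]. Qed.

Lemma dim_full n : has_dim (fun=> True) n (V := 'rV[rat]_n).
Proof.
exists idfun; split=> // v; split=> // _; by exists v.
Qed.

Lemma has_dim_matrix (V W : lmodType rat) (P : V -> Prop) (Q : W -> Prop) d e
    (phi : {linear 'rV[rat]_d -> V}) (psi : {linear 'rV[rat]_e -> W})
    (T : {linear V -> W}) :
  (forall v, P v <-> exists c, v = phi c) -> injective psi ->
  (forall v, Q v <-> exists c, v = psi c) ->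
  (forall v, P v -> Q (T v)) ->
  exists M : 'M_(d, e), forall c, T (phi c) = psi (c *m M).
Proof.
move=> hP ipsi hQ hT.
have /choice [F hF] : forall c, exists c', T (phi c) = psi c'.
  by move=> c; apply/hQ/hT/hP; exists c.
have linF : linear F.
  by move=> a u v; apply: ipsi; rewrite -hF !linearP /= !hF.
have [F' hF'] := linear_pack linF.
exists (lin1_mx F') => c.
by rewrite mul_rV_lin1 /= hF' hF.
Qed.

(** The matrix of [T] has [e] columns, hence rank at most [e]. The images of the relator operators
    are never computed, so the result is an inequality. *)
Lemma rank_nullity (V W : lmodType rat) (P : V -> Prop) (Q : W -> Prop) d e
    (T : {linear V -> W}) :
  has_dim P d -> has_dim Q e -> (forall v, P v -> Q (T v)) ->
  exists2 r, has_dim (fun v => P v /\ T v = 0) r & (d <= r + e)%N.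
Proof.
move=> [phi [iphi hP]] [psi [ipsi hQ]] hT.
have [M hM] := has_dim_matrix hP ipsi hQ hT.
exists (\rank (kermx M)); last first.
  by rewrite mxrank_ker addnC -leq_subLR leq_sub2l // rank_leq_col.
pose K := row_base (kermx M).
have [F hF] : exists F : {linear 'rV_(\rank (kermx M)) -> V},
    F =1 (fun c => phi (c *m K)).
  by apply: linear_pack => a u v; rewrite mulmxDl -scalemxAl linearP.
exists F; split=> [u v|v].
  by rewrite !hF => /iphi /(row_free_inj (row_base_free _)).
split=> [[/hP [c ->]]|[c ->]].
  rewrite hM -(linear0 psi) => /ipsi cM0.
  have /submxP [u ->] : (c <= K)%MS by rewrite eq_row_base; apply/sub_kermxP.
  by exists u; rewrite hF.
rewrite hF; split; first by apply/hP; exists (c *m K).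
rewrite hM.
have /sub_kermxP -> : (c *m K <= kermx M)%MS.
  by apply: submx_trans (submxMl _ _) _; rewrite eq_row_base.
exact: linear0.
Qed.

Lemma dim_eq0 (V : lmodType rat) (P : V -> Prop) r :
  has_dim P r -> (forall v, P v -> v = 0) -> r = 0%N.
Proof.
move=> [phi [iphi hP]] h0; case: r phi iphi hP => // r phi iphi hP.
have /iphi /rowP /(_ 0) : phi (const_mx 1) = phi 0.
  by rewrite linear0; apply: h0; apply/hP; exists (const_mx 1).
by rewrite !mxE => /eqP; rewrite oner_eq0.
Qed.

Lemma dim_le (V W : lmodType rat) (P : V -> Prop) (Q : W -> Prop) d e
    (T : {linear V -> W}) :
  has_dim P d -> has_dim Q e -> (forall v, P v -> Q (T v)) ->
  (forall v, P v -> T v = 0 -> v = 0) -> (d <= e)%N.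
Proof.
move=> hP hQ hT hi; have [r hr] := rank_nullity hP hQ hT.
by rewrite (dim_eq0 hr) // => v []; apply: hi.
Qed.

Lemma dim_sub (V : lmodType rat) (P Q : V -> Prop) d e :
  has_dim P d -> has_dim Q e -> (forall v, P v -> Q v) -> (d <= e)%N.
Proof. by move=> hP hQ PQ; apply: (dim_le (T := idfun) hP hQ). Qed.

Lemma dim_unique (V : lmodType rat) (P : V -> Prop) d e :
  has_dim P d -> has_dim P e -> d = e.
Proof. by move=> hd he; apply/eqP; rewrite eqn_leq !(@dim_sub _ P P). Qed.

Lemma dim_sub_eq (V : lmodType rat) (P Q : V -> Prop) d e :
  has_dim P d -> has_dim Q e -> (forall v, P v -> Q v) -> (e <= d)%N ->
  forall v, Q v -> P v.
Proof.
move=> hP hQ PQ le_ed; have := dim_sub hP hQ PQ.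
move=> le_de; have {le_ed le_de} de : d = e by apply/eqP; rewrite eqn_leq le_de.
move: hP hQ; rewrite {}de => -[phi [iphi hP]] [psi [ipsi hQ]].
have [M hM] := has_dim_matrix (T := idfun) hP ipsi hQ PQ.
have {}hM c : phi c = psi (c *m M) := hM c.
have fM : row_free M.
  by apply: inj_row_free => c cM0; apply: iphi; rewrite linear0 (hM c) cM0 linear0.
move=> v /hQ [c ->]; apply/hP; exists (c *m invmx M).
have uM : M \in unitmx by rewrite -row_free_unit.
by rewrite (hM _) mulmxKV.
Qed.

(** Preimages [S i] of a basis of [Q] give a section [s] of [T], and [P] is the direct sum of the
    kernel and the image of [s]. *)
Lemma dim_extension (V W : lmodType rat) (P : V -> Prop) (Q : W -> Prop) d e
    (T : {linear V -> W}) :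
  (forall a u v, P u -> P v -> P (a *: u + v)) ->
  has_dim (fun v => P v /\ T v = 0) d -> has_dim Q e ->
  (forall v, P v -> Q (T v)) -> (forall w, Q w -> exists2 v, P v & T v = w) ->
  has_dim P (d + e).
Proof.
move=> linP [phi [iphi hK]] [psi [ipsi hQ]] hT surjT.
have P0 : P 0 by apply: (proj1 (_ : P 0 /\ T 0 = 0)); apply/hK; exists 0; rewrite linear0.
have /choice [S hS] : forall i : 'I_e, exists v, P v /\ T v = psi (delta_mx 0 i).
  by move=> i; have [|v] := surjT (psi (delta_mx 0 i)); [apply/hQ; eexists|exists v].
pose s (c : 'rV[rat]_e) := \sum_i c 0 i *: S i.
have Ps c : P (s c).
  rewrite /s; elim/big_rec: _ => // i x _ Px.
  by apply: linP => //; case: (hS i).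
have Ts c : T (s c) = psi c.
  rewrite /s linear_sum [in RHS](row_sum_delta c) linear_sum.
  by apply: eq_bigr => i _; rewrite !linearZ /= (proj2 (hS i)).
have [F hF] : exists F : {linear 'rV_(d + e) -> V},
    F =1 (fun c => phi (lsubmx c) + s (rsubmx c)).
  apply: linear_pack => a u v; rewrite !linearP /= scalerDr addrACA; congr (_ + _).
  rewrite /s scaler_sumr -big_split /=; apply: eq_bigr => i _.
  by rewrite !mxE scalerDl scalerA.
have TF c : T (F c) = psi (rsubmx c).
  rewrite hF linearD Ts; have [_ ->] : P (phi (lsubmx c)) /\ T (phi (lsubmx c)) = 0.
    by apply/hK; eexists.
  by rewrite add0r.
exists F; split=> [u v uv|v].
  have er : rsubmx u = rsubmx v by apply: ipsi; rewrite -!TF uv.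
  move: uv; rewrite !hF er => /addIr /iphi el.
  by rewrite -[u]hsubmxK -[v]hsubmxK el er.
split=> [Pv|[c ->]]; last first.
  rewrite hF -[phi _]scale1r; apply: linP => //.
  by apply: (proj1 (_ : P _ /\ T _ = 0)); apply/hK; eexists.
have /hQ [b hb] := hT v Pv.
have /hK [a ha] : P (v - s b) /\ T (v - s b) = 0.
  split; first by rewrite addrC -scaleN1r; apply: linP.
  by rewrite linearB Ts hb subrr.
exists (row_mx a b); rewrite hF row_mxKl row_mxKr -ha subrK //.
Qed.

Lemma dim_power (V : lmodType rat) (P : V -> Prop) d n :
  has_dim P d -> has_dim (fun p : 'I_n -> V => forall i, P (p i)) (n * d).
Proof.
move=> [phi [iphi hP]].
have [F hF] : exists F : {linear 'rV_(n * d) -> ('I_n -> V)},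
    F =1 (fun c i => phi (row i (vec_mx c))).
  by apply: linear_pack => a u v; apply/funext => i; rewrite !linearP.
exists F; split=> [u v|p].
  rewrite !hF => uv; rewrite -[u]vec_mxK -[v]vec_mxK; congr mxvec.
  by apply/row_matrixP => i; apply: iphi; exact: (congr1 (@^~ i) uv).
split=> [/(_ _)/hP hp|[c ->] i]; last by rewrite hF; apply/hP; eexists.
have /choice [c hc] := fun i => (proj1 (hP _)) (proj2 (hP (p i)) (hp i)).
exists (mxvec (\matrix_i c i)); rewrite hF; apply/funext => i.
by rewrite mxvecK rowK.
Qed.

Lemma dim_line (V : lmodType rat) (P : V -> Prop) v0 :
  v0 != 0 -> (forall v, P v <-> exists a, v = a *: v0) -> has_dim P 1.
Proof.
move=> nz hP.
have [F hF] : exists F : {linear 'rV_1 -> V}, F =1 (fun c => c 0 0 *: v0).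
  by apply: linear_pack => a u v; rewrite !mxE scalerDl scalerA.
exists F; split=> [u v|v].
  rewrite !hF => /eqP; rewrite -subr_eq0 -scalerBl scaler_eq0 (negPf nz) orbF.
  by rewrite subr_eq0 => /eqP e; apply/rowP => i; rewrite ord1.
rewrite hP; split=> [[a ->]|[c ->]]; last by eexists; rewrite hF.
by exists (const_mx a); rewrite hF mxE.
Qed.

Lemma dim_ge_free (V : lmodType rat) (P : V -> Prop) d e
    (phi : {linear 'rV[rat]_d -> V}) :
  has_dim P e -> (forall c, P (phi c)) -> (forall c, phi c = 0 -> c = 0) ->
  (d <= e)%N.
Proof.
move=> hP Pphi phi0.
by apply: (dim_le (T := phi) (dim_full d) hP) => c // _; apply: phi0.
Qed.

End FiniteDimension.

(** * Polynomial functions on a group *)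

Section PolynomialFunctions.
Variable G : groupType.
Implicit Types (f : G -> rat^o) (g h : G).

Definition ldiff h f : G -> rat^o := fun g => f (h * g)%g - f g.
Definition rdiff h f : G -> rat^o := fun g => f (g * h)%g - f g.

(* [polyfun c] is the space of polynomial functions of degree less than [c],
   that is, the dual of the quotient of the group ring by the [c]-th power of
   its augmentation ideal. *)
Fixpoint polyfun c f : Prop :=
  if c is c'.+1 then forall h, polyfun c' (ldiff h f) else f = 0.

Lemma ldiff_linear h : linear (ldiff h).
Proof.
move=> a u v; apply/funext => g; rewrite /ldiff !fctE /=.
by rewrite !scalerDr !scalerN opprD addrACA.
Qed.

Lemma ldiff0 h : ldiff h 0 = 0.
Proof. by apply/funext => g; rewrite /ldiff subr0. Qed.

Lemma ldiff_cst h (a : rat) : ldiff h (fun=> a) = 0.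
Proof. by apply/funext => g; rewrite /ldiff subrr. Qed.

Lemma polyfun_linear c a u v :
  polyfun c u -> polyfun c v -> polyfun c (a *: u + v).
Proof.
elim: c u v => [|c IHc] u v /=; first by move=> -> ->; rewrite scaler0 addr0.
by move=> hu hv h; rewrite ldiff_linear; apply: IHc.
Qed.

Lemma polyfun0 c : polyfun c 0.
Proof. by elim: c => //= c IHc h; rewrite ldiff0. Qed.

Lemma polyfunD c u v : polyfun c u -> polyfun c v -> polyfun c (u + v).
Proof. by move=> hu hv; rewrite -[u]scale1r; apply: polyfun_linear. Qed.

Lemma polyfunZ c a u : polyfun c u -> polyfun c (a *: u).
Proof. by move=> hu; rewrite -[_ *: _]addr0; apply/polyfun_linear/polyfun0. Qed.

Lemma polyfunN c u : polyfun c u -> polyfun c (- u).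
Proof. by move=> hu; rewrite -scaleN1r; apply: polyfunZ. Qed.

Lemma polyfun_sum c I (r : seq I) (P : pred I) (F : I -> G -> rat^o) :
  (forall i, P i -> polyfun c (F i)) -> polyfun c (\sum_(i <- r | P i) F i).
Proof.
move=> hF; elim/big_rec: _ => [|i x Pi hx]; first exact: polyfun0.
by apply/polyfunD/hx/hF.
Qed.

Lemma polyfunS c f : polyfun c f -> polyfun c.+1 f.
Proof.
elim: c f => [|c IHc] f /=; first by move=> -> h; rewrite ldiff0.
by move=> hf h; apply: IHc.
Qed.

Lemma polyfunW b c f : (b <= c)%N -> polyfun b f -> polyfun c f.
Proof.
by move=> /subnK <-; elim: (c - b)%N => //= k IHk /IHk; apply: polyfunS.
Qed.

Lemma polyfun_cst c (a : rat) : polyfun c.+1 (fun=> a).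
Proof. by move=> h; rewrite ldiff_cst; apply: polyfun0. Qed.

Lemma polyfun1 f : polyfun 1 f -> f = fun=> f 1%g.
Proof.
move=> hf; apply/funext => g; have /(congr1 (@^~ 1%g)) := hf g.
by rewrite /ldiff mulg1 => /eqP; rewrite subr_eq0 => /eqP.
Qed.

Lemma polyfun_lmul c k f : polyfun c f -> polyfun c (fun g => f (k * g)%g).
Proof.
case: c => [->//|c] hf.
have -> : (fun g => f (k * g)%g) = ldiff k f + f.
  by apply/funext => g; rewrite /ldiff !fctE subrK.
by apply: polyfunD => //; apply/polyfunS/hf.
Qed.

(** Left and right differences commute. Equivariance is about left differences, while Fox calculus
    produces right ones; this equivalence links the two. *)
Lemma polyfunSr c f : polyfun c.+1 f <-> forall h, polyfun c (rdiff h f).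
Proof.
have comm h k u : ldiff h (rdiff k u) = rdiff k (ldiff h u).
  apply/funext => g; rewrite /ldiff /rdiff !mulgA !opprB addrACA.
  by rewrite [- _ + _ as X in _ + X]addrC addrACA.
elim: c f => [|c IHc] f.
  split=> [/polyfun1 -> h|hf h]; first by apply/funext => g; rewrite /rdiff subrr.
  apply/funext => g; have fE k : f k = f 1%g.
    have /(congr1 (@^~ 1%g)) := hf k.
    by rewrite /rdiff mul1g => /eqP; rewrite subr_eq0 => /eqP.
  by rewrite /ldiff [f (h * g)%g]fE [f g]fE subrr.
split=> [hf k h|hf h].
  by rewrite comm; move: k; apply/IHc/hf.
by apply/IHc => k; rewrite -comm; apply: hf.
Qed.

Lemma polyfun_rmul c k f : polyfun c f -> polyfun c (fun g => f (g * k)%g).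
Proof.
case: c => [->//|c] hf.
have -> : (fun g => f (g * k)%g) = rdiff k f + f.
  by apply/funext => g; rewrite /rdiff !fctE subrK.
by apply: polyfunD => //; apply: polyfunS; move: k; apply/polyfunSr.
Qed.

Lemma polyfun_additive f :
  (forall g h, f (g * h)%g = f g + f h) -> polyfun 2 f.
Proof.
move=> hf h; have -> : ldiff h f = fun=> f h.
  by apply/funext => g; rewrite /ldiff hf addrK.
exact: (@polyfun_cst 0).
Qed.

(** Leibniz rule: the difference of the product along [h] is [a] times the difference of [f],
    treated by induction, plus [a h] times a translate of [f]. *)
Lemma polyfunM_additive c a f :
  (forall g h, a (g * h)%g = a g + a h) -> polyfun c f ->
  polyfun c.+1 (fun g => a g * f g).
Proof.
move=> ha; elim: c f => [|c IHc] f hf.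
  rewrite (_ : (fun g => _) = 0); first exact: polyfun0.
  by apply/funext => g; rewrite hf [X in _ * X]/0 /= mulr0.
move=> h; have -> : ldiff h (fun g => a g * f g)
    = (fun g => a g * ldiff h f g) + a h *: (fun g => f (h * g)%g).
  apply/funext => g; rewrite /ldiff !fctE /= ha mulrDl mulrBr addrAC [RHS]addrC.
  by rewrite addrA [in RHS]addrAC.
apply: polyfunD; first exact/IHc/hf.
exact/polyfunZ/polyfun_lmul.
Qed.

(** On the powers of [g] a function of degree less than [c] is a polynomial in the exponent,
    determined by its values at the first [c] exponents. *)
Lemma polyfun_powers_eq0 c f g : polyfun c f ->
  (forall e, (e < c)%N -> f (g ^+ e)%g = 0) -> forall e, f (g ^+ e)%g = 0.
Proof.
elim: c f => [|c IHc] f hf f0 e; first by rewrite hf.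
have df0 : forall e', ldiff g f (g ^+ e')%g = 0.
  apply: IHc => [|e' lt_e'c]; first exact: hf.
  by rewrite /ldiff -expgS !f0 ?subr0 // ltnS // ltnW.
elim: e => [|e IHe]; first exact: f0.
by have := df0 e; rewrite /ldiff -expgS IHe subr0.
Qed.

(** A missing exponent counts as zero and surplus ones are ignored, so lists of exponents need no
    length condition. Exponents are natural numbers: inverses must occur in [s] themselves. *)
Fixpoint power_product (s : seq G) (es : seq nat) : G :=
  if s is g :: s' then (g ^+ head 0%N es * power_product s' (behead es))%g
  else 1%g.

Lemma polyfun_power_product_eq0 c f s : polyfun c f ->
  (forall es : (size s).-tuple 'I_c, f (power_product s (map val es)) = 0) ->
  forall es, f (power_product s es) = 0.
Proof.
elim: s f => [|g s IHs] f hf f0 es; first by rewrite -(f0 [tuple]).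
rewrite /=; set b := power_product s _; move: (head _ _) => e.
(* One factor varies at a time: with the tail [b] fixed, [u] is a right translate of [f], considered
   on the powers of [g]. *)
pose u k := f (k * b)%g; rewrite -/(u (g ^+ e)%g).
apply: (@polyfun_powers_eq0 c) => [|{}e lt_ec]; first exact: polyfun_rmul.
rewrite /u /b; apply: (IHs (fun k => f (g ^+ e * k)%g)) => [|es'].
  exact: polyfun_lmul.
exact: (f0 [tuple of Ordinal lt_ec :: es']).
Qed.

(** Restriction to the grid of products with all exponents below [c] is injective on [polyfun c],
    and [c ^ size s] tuples index the grid. *)
Lemma polyfun_dim_bound s : (forall x, exists es, x = power_product s es) ->
  forall c d, has_dim (polyfun c) d -> (d <= c ^ size s)%N.
Proof.
move=> hs c d hd.
pose ev (i : 'I_#|{: (size s).-tuple 'I_c}|) : (size s).-tuple 'I_c := enum_val i.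
have [T hT] : exists T : {linear (G -> rat^o) -> 'rV[rat]_#|{: (size s).-tuple 'I_c}|},
    T =1 (fun f => \row_i f (power_product s (map val (ev i)))).
  by apply: linear_pack => a u v; apply/rowP => i; rewrite !mxE.
suff : (d <= #|{: (size s).-tuple 'I_c}|)%N by rewrite card_tuple card_ord.
apply: (dim_le (T := T) hd (dim_full _)) => // f hf Tf0.
apply/funext => x; have [es ->] := hs x.
apply: polyfun_power_product_eq0 hf _ _ => es'.
by have /rowP /(_ (enum_rank es')) := Tf0; rewrite hT !mxE /ev enum_rankK.
Qed.

End PolynomialFunctions.

(** * Splitting the exponent matrix *)

Section RankSplitting.
Variables (F : fieldType) (n m : nat).

(** For the exponent matrix [X], the columns of [Z] span the combinations of relators with zero
    exponent sums and those of [Y] span a complement; [Y'] and [Z'] recover the relators from both.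
    [P] is injective on the left kernel of [X], a space of dimension [d]. *)
Lemma rank_splitting (X : 'M[F]_(n, m)) :
  exists e1 e2 d (Y : 'M_(m, e1)) (Y' : 'M_(e1, m)) (Z : 'M_(m, e2))
         (Z' : 'M_(e2, m)) (P : 'M_(n, d)),
    [/\ (e1 + e2 = m)%N, (e1 + d = n)%N, Y *m Y' + Z *m Z' = 1%:M, X *m Z = 0 &
        forall v : 'rV_n, v *m X = 0 -> v *m P = 0 -> v = 0].
Proof.
pose K := kermx X^T; pose C := X^T.
have rK : \rank K = (m - \rank X)%N by rewrite mxrank_ker mxrank_tr.
have rKC : \rank (K^C)%MS = \rank X.
  by rewrite mxrank_compl rK subKn // rank_leq_col.
have : (1%:M <= row_base (K^C)%MS + row_base K)%MS.
  by rewrite (adds_eqmx (eq_row_base _) (eq_row_base _)) addsmxC sub1mx addsmx_compl_full.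
case/sub_addsmxP => -[A B] /= AB.
have : row_full (col_mx X^T (row_base (X^T^C)%MS)).
  by rewrite -sub1mx -addsmxE (adds_eqmx (eqmx_refl _) (eq_row_base _)) sub1mx addsmx_compl_full.
move=> fullX.
exists (\rank (K^C)%MS), (\rank K), (\rank (X^T^C)%MS),
  (row_base (K^C)%MS)^T, A^T, (row_base K)^T, B^T, (row_base (X^T^C)%MS)^T.
split.
- by rewrite rKC rK subnKC // rank_leq_col.
- by rewrite rKC mxrank_compl mxrank_tr subnKC // rank_leq_row.
- by rewrite -!trmx_mul -linearD /= -AB trmx1.
- apply: trmx_inj; rewrite trmx_mul trmxK trmx0; apply/sub_kermxP.
  by rewrite eq_row_base.
move=> v vX vP; apply: trmx_inj; rewrite trmx0.
apply: (row_full_inj fullX).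
by rewrite mulmx0 mul_col_mx -[X in col_mx (_ *m _) (X *m _)]trmxK -!trmx_mul vX vP !trmx0 col_mx0.
Qed.

End RankSplitting.

(** * Operators commuting with differences *)

Section EquivariantOperators.
Variable G : groupType.
Notation V := (G -> rat^o).

Definition tuple_ldiff n h (p : 'I_n -> V) : 'I_n -> V := fun i => ldiff h (p i).
Definition tuple_poly n c (p : 'I_n -> V) := forall i, polyfun c (p i).
Definition tuple_cst n (v : 'rV[rat]_n) : 'I_n -> V := fun i _ => v 0 i.

(** For a linear [T] this amounts to commuting with left translations. *)
Definition equivariant n m (T : ('I_n -> V) -> ('I_m -> V)) :=
  forall h p, T (tuple_ldiff h p) = tuple_ldiff h (T p).

Definition mix n m (M : 'M[rat]_(n, m)) (p : 'I_n -> V) : 'I_m -> V :=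
  fun j => \sum_i M i j *: p i.

Lemma tuple_ldiff0 n h : tuple_ldiff h 0 = 0 :> ('I_n -> V).
Proof. by apply/funext => i; apply: ldiff0. Qed.

Lemma tuple_poly1 n (p : 'I_n -> V) :
  tuple_poly 1 p <-> exists v, p = tuple_cst v.
Proof.
split=> [hp|[v ->] i]; last exact: (@polyfun_cst _ 0).
by exists (\row_i p i 1%g); apply/funext => i; rewrite (polyfun1 (hp i)) /tuple_cst mxE.
Qed.

Lemma tuple_cst_eq0 n (v : 'rV[rat]_n) : tuple_cst v = 0 -> v = 0.
Proof.
by move=> v0; apply/rowP => i; rewrite mxE; exact: (congr1 (fun p => p i 1%g) v0).
Qed.

Lemma mix_linear n m (M : 'M_(n, m)) : linear (mix M).
Proof.
move=> a u v; apply/funext => j; rewrite /mix.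
rewrite -[RHS]/(a *: (\sum_i M i j *: u i) + \sum_i M i j *: v i).
rewrite scaler_sumr -big_split /=; apply: eq_bigr => i _.
by rewrite -[(_ + v) i]/(a *: u i + v i) scalerDr !scalerA mulrC.
Qed.

Lemma mix_equivariant n m (M : 'M_(n, m)) : equivariant (mix M).
Proof.
move=> h p; apply/funext => j; rewrite /mix /tuple_ldiff.
have [L hL] := linear_pack (@ldiff_linear G h).
rewrite -hL linear_sum; apply: eq_bigr => i _.
by rewrite linearZ hL.
Qed.

Lemma mix_poly n m (M : 'M_(n, m)) c p : tuple_poly c p -> tuple_poly c (mix M p).
Proof. by move=> hp j; apply: polyfun_sum => i _; apply/polyfunZ/hp. Qed.

Lemma mixM n m k (M : 'M_(n, m)) (N : 'M_(m, k)) p :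
  mix N (mix M p) = mix (M *m N) p.
Proof.
apply/funext => j; rewrite /mix.
under eq_bigr do rewrite scaler_sumr.
rewrite exchange_big; apply: eq_bigr => i _.
by rewrite mxE scaler_suml; apply: eq_bigr => l _; rewrite scalerA mulrC.
Qed.

Lemma mixD n m (M N : 'M_(n, m)) p : mix (M + N) p = mix M p + mix N p.
Proof.
apply/funext => j; rewrite /mix.
rewrite -[RHS]/(\sum_i M i j *: p i + \sum_i N i j *: p i) -big_split; apply: eq_bigr => i _.
by rewrite mxE scalerDl.
Qed.

Lemma mix1 n (p : 'I_n -> V) : mix 1%:M p = p.
Proof.
apply/funext => j; rewrite /mix (bigD1 j) //= mxE eqxx scale1r.
by rewrite big1 ?addr0 // => i /negPf ij; rewrite mxE ij scale0r.
Qed.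

Lemma mix0 n m (M : 'M_(n, m)) : mix M 0 = 0.
Proof. by apply/funext => j; rewrite /mix big1 // => i _; rewrite scaler0. Qed.

Lemma mix_cst n m (M : 'M_(n, m)) v : mix M (tuple_cst v) = tuple_cst (v *m M).
Proof.
apply/funext => j; apply/funext => g; rewrite /mix /tuple_cst mxE fct_sumE.
by apply: eq_bigr => i _; rewrite fctE mulrC.
Qed.

(** Repeated differences of a nonzero polynomial tuple lead to a nonzero constant tuple, which [R]
    excludes. So injectivity of equivariant operators may be tested on constants. *)
Lemma equivariant_eq0 n (R : ('I_n -> V) -> Prop) :
  (forall h p, R p -> R (tuple_ldiff h p)) ->
  (forall v, R (tuple_cst v) -> v = 0) ->
  forall c p, R p -> tuple_poly c p -> p = 0.
Proof.
move=> RD R1; elim=> [|c IHc] p Rp hp; first by apply/funext => i; apply: hp.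
have [v pE] : exists v, p = tuple_cst v.
  apply/tuple_poly1 => i h.
  suff /(congr1 (@^~ i)) : tuple_ldiff h p = 0 by [].
  by apply: IHc => [|{}i]; [exact: RD|exact: hp].
by apply/funext => i; apply/funext => g; rewrite pE (R1 v) -?pE // /tuple_cst mxE.
Qed.

Lemma equivariant_lowers n m (R : ('I_n -> V) -> Prop)
    (T : ('I_n -> V) -> ('I_m -> V)) s :
  equivariant T ->
  (forall h p, R p -> R (tuple_ldiff h p)) ->
  (forall p, R p -> tuple_poly s p -> T p = 0) ->
  forall c p, R p -> tuple_poly c p -> tuple_poly (c - s) (T p).
Proof.
move=> eT RD Ts c p Rp hp.
(* If [c < s], then [c - s] is 0 and the claim is that [T p] vanishes; passing to degree less than
   [c - s + s] covers this case too. *)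
have {}hp : tuple_poly (c - s + s) p.
  by move=> i; apply: (polyfunW _ (hp i)); rewrite addnC -leq_subLR.
elim: (c - s)%N p Rp hp => [|k IHk] p Rp hp j; first by rewrite /= Ts.
move=> h; rewrite -[ldiff _ _]/(tuple_ldiff h (T p) j) -eT.
by apply: IHk => [|i]; [exact: RD|exact: hp].
Qed.

Section Recurrence.
Variables (n m : nat) (X : 'M[rat]_(n, m)) (T : {linear ('I_n -> V) -> ('I_m -> V)}).
Hypothesis T_equivariant : equivariant T.
Hypothesis T_poly : forall c p, tuple_poly c p -> tuple_poly c (T p).
Hypothesis T_cst : forall v, T (tuple_cst v) = tuple_cst (v *m X).
Variables b z : nat -> nat.
Hypothesis dimP : forall c, has_dim (@polyfun G c) (b c).
Hypothesis dimZ : forall c,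
  has_dim (fun p : 'I_n -> V => tuple_poly c p /\ T p = 0) (z c).
Hypothesis b1 : b 1 = 1%N.

(* [Y] recombines the relators into [e1 = \rank X] ones with independent exponent
   vectors, and [Z] into [e2] ones with zero exponent sums, so that the operator
   [S] defined by [Z] lowers degrees by one. If [z 2] is maximal, then [S] kills
   the kernel of [U] in degree less than 2, and so it lowers degrees by two. *)
Lemma kernel_dim_recurrence : exists e1 e2 d,
  [/\ e1 + e2 = m, e1 + d = n, z 1 = d,
      forall c, d * b c <= z c + e2 * b (c - 1) &
      d * b 2 <= z 2 -> forall c, d * b c <= z c + e2 * b (c - 2)]%N.
Proof.
have [e1 [e2 [d [Y [Y' [Z [Z' [P [m_e n_e YZ XZ XP]]]]]]]]] := rank_splitting X.
exists e1, e2, d.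
have pack k (M : 'M_(m, k)) : exists U : {linear ('I_n -> V) -> ('I_k -> V)},
    U =1 mix M \o T.
  by apply: linear_pack => a u v; rewrite /= linearP mix_linear.
have [[U hU] [S hS]] := (pack _ Y, pack _ Z).
have mixT_equi k (M : 'M_(m, k)) (W : ('I_n -> V) -> ('I_k -> V)) :
    W =1 mix M \o T -> equivariant W.
  by move=> hW h p; rewrite !hW /= T_equivariant mix_equivariant.
have eU := mixT_equi _ _ _ hU; have eS := mixT_equi _ _ _ hS.
pose K c p := tuple_poly c p /\ U p = 0.
(* [U] and [S] together carry the same information as [T], because [Y *m Y' + Z *m Z'] is the
   identity. *)
have KZ c p : tuple_poly c p /\ T p = 0 <-> K c p /\ S p = 0.
  split=> [[hp Tp]|[[hp Up] Sp]].
    by rewrite /K hU hS /= Tp !mix0.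
  split=> //; rewrite -[T p]mix1 -YZ mixD -!mixM.
  by move: Up Sp; rewrite hU hS /= => -> ->; rewrite !mix0 addr0.
have U_poly c p : tuple_poly c p -> tuple_poly c (U p).
  by rewrite hU => hp; apply/mix_poly/T_poly.
have /choice [k hk] c : exists k,
    has_dim (K c) k /\ (n * b c <= k + e1 * b c)%N.
  have [k] := rank_nullity (dim_power n (dimP c)) (dim_power e1 (dimP c)) (U_poly c).
  by exists k.
have dimK c := proj1 (hk c).
have ge_k c : (d * b c <= k c)%N.
  by rewrite -(leq_add2r (e1 * b c)) -mulnDl addnC n_e (proj2 (hk c)).
have UldiffE h p : U p = 0 -> U (tuple_ldiff h p) = 0.
  by rewrite eU => ->; rewrite tuple_ldiff0.
have Scst v : S (tuple_cst v) = 0.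
  rewrite hS /= T_cst mix_cst -mulmxA XZ mulmx0.
  by apply/funext => i; apply/funext => g; rewrite /tuple_cst mxE.
(* [P] embeds the tuples killed by [U] into [d] copies of the polynomial functions: on constants,
   [U] vanishes exactly on the left kernel of [X]. *)
have le_k c : (k c <= d * b c)%N.
  have [L hL] := linear_pack (mix_linear P).
  apply: (dim_le (T := L) (dimK c) (dim_power d (dimP c))) => p [hp Up].
    by rewrite hL; apply: mix_poly.
  move=> Lp; pose R p := U p = 0 /\ mix P p = 0.
  apply: (@equivariant_eq0 _ R) (hp); last by rewrite /R -hL.
    by move=> h q [Uq Pq]; split; rewrite ?UldiffE // mix_equivariant Pq tuple_ldiff0.
  move=> v []; rewrite hU /= T_cst !mix_cst => /tuple_cst_eq0 vXY /tuple_cst_eq0.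
  apply: XP; rewrite -[v *m X]mulmx1 -YZ mulmxDr !mulmxA vXY mul0mx add0r.
  by rewrite -[v *m X *m Z]mulmxA XZ mulmx0 mul0mx.
have step s c :
    (forall p, U p = 0 -> tuple_poly s p -> S p = 0) ->
    (d * b c <= z c + e2 * b (c - s))%N.
  move=> Ss.
  have [r hr le_r] := rank_nullity (T := S) (dimK c)
    (dim_power e2 (dimP (c - s)))
    (fun p hp => equivariant_lowers eS UldiffE Ss (proj2 hp) (proj1 hp)).
  apply: leq_trans (ge_k c) (leq_trans le_r _); rewrite leq_add2r.
  by apply: (dim_sub hr (dimZ c)) => p /KZ.
have S1 p : U p = 0 -> tuple_poly 1 p -> S p = 0.
  by move=> _ /tuple_poly1 [v ->]; apply: Scst.
split=> // [|c|z2 c]; [|exact: step|].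
- apply/eqP; rewrite eqn_leq; apply/andP; split.
    have := le_k 1%N; rewrite b1 muln1; apply: leq_trans.
    by apply: (dim_sub (dimZ 1) (dimK 1)) => p /KZ [].
  have := ge_k 1%N; rewrite b1 muln1 => /leq_trans; apply.
  apply: (dim_sub (dimK 1) (dimZ 1)) => p Kp; apply/KZ; split => //.
  by case: Kp => hp Up; apply: S1.
(* Maximality of [z 2] makes the kernel of [T] in degree less than 2 all of [K 2], so [S] vanishes
   there. *)
apply: step => p Up hp.
have /KZ [] // : tuple_poly 2 p /\ T p = 0.
apply: (dim_sub_eq (dimZ 2) (dimK 2)) (conj hp Up); first by move=> q /KZ [].
exact: leq_trans (le_k 2%N) z2.
Qed.

End Recurrence.
End EquivariantOperators.

(** * Group morphisms and evaluation of words *)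

Section GroupMorphisms.
Local Open Scope group_scope.
Variables (G H : groupType) (f : G -> H).
Hypothesis fM : {morph f : x y / x * y}.

Lemma morph_1 : f 1 = 1.
Proof. by apply: (mulgI (f 1)); rewrite -fM !mulg1. Qed.

Lemma morph_V : {morph f : x / x^-1}.
Proof. by move=> x; apply/esym/mulg1_eq; rewrite -fM mulgV morph_1. Qed.

Lemma morph_J : {morph f : x y / x ^ y}.
Proof. by move=> x y; rewrite !conjgE !fM morph_V. Qed.

Lemma morph_R : {morph f : x y / [~ x, y]}.
Proof. by move=> x y; rewrite !commgEl fM morph_V morph_J. Qed.

Lemma morph_X n : {morph f : x / x ^+ n}.
Proof. by elim: n => [|n IHn] x; rewrite ?morph_1 // !expgS fM IHn. Qed.

End GroupMorphisms.

Section FreeGroupEvaluation.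
Local Open Scope group_scope.
Variables (X : choiceType) (H : groupType) (x : X -> H).
Notation letter := (X * bool)%type.
Implicit Types (a : letter) (u v w : seq letter).

Definition letter_value a : H := if a.2 then (x a.1)^-1 else x a.1.
Definition word_value w : H := foldr (fun a h => letter_value a * h) 1 w.

Lemma letter_value_inv a : letter_value (letter_inv a) = (letter_value a)^-1.
Proof. by case: a => y [] //=; rewrite /letter_value /= invgK. Qed.

Lemma word_value_cons a w :
  word_value (word_cons a w) = letter_value a * word_value w.
Proof. by case: w => //= b w; case: eqP => //= ->; rewrite letter_value_inv mulVKg. Qed.

Lemma word_value_mul u v : word_value (word_mul u v) = word_value u * word_value v.
Proof. by elim: u => [|a u IHu] /=; rewrite ?mul1g // word_value_cons IHu mulgA. Qed.

Definition free_eval (w : free_group X) : H := word_value w.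

Lemma free_evalM : {morph free_eval : u v / u * v}.
Proof. by move=> u v; apply: word_value_mul. Qed.

End FreeGroupEvaluation.

Section FreeGroupLetters.
Local Open Scope group_scope.
Variable X : choiceType.

Definition free_letter (a : X * bool) : free_group X :=
  @FreeGroup X [:: a] isT.
Definition free_gen (y : X) : free_group X := free_letter (y, false).

Lemma free_letterE a : free_letter a = letter_value free_gen a.
Proof. by case: a => y [] //; apply/val_inj. Qed.

Lemma free_group_ind (P : free_group X -> Prop) :
  P 1 -> (forall a w, P w -> P (free_letter a * w)) -> forall w, P w.
Proof.
move=> P1 PM [w rw]; elim: w rw => [|a w IHw] rw.
  by rewrite (_ : FreeGroup rw = 1) //; apply/val_inj.
have rw' : reduced w by apply: path_sorted rw.
rewrite (_ : FreeGroup rw = free_letter a * FreeGroup rw').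
  exact/PM/IHw.
apply/val_inj => /=; case: w rw {IHw rw'} => //= b w /andP[/negPf-> _] //.
Qed.

Lemma free_group_morphE (H : groupType) (phi : free_group X -> H) :
  {morph phi : u v / u * v} -> phi =1 free_eval (phi \o free_gen).
Proof.
move=> phiM; elim/free_group_ind=> [|a w IHw]; first exact: morph_1.
rewrite phiM free_evalM IHw; congr (_ * _); rewrite free_letterE /free_eval /=.
by case: a => y [] /=; rewrite mulg1 ?(morph_V phiM).
Qed.

End FreeGroupLetters.

(** * Fox calculus with values in functions on the group *)

Section FoxCalculus.
Variables (G : groupType) (n : nat) (x : 'I_n -> G).
Notation V := (G -> rat^o).
Notation letter := ('I_n * bool)%type.
Implicit Types (p : 'I_n -> V) (a : letter).

(** The value on an inverse letter is forced by the crossed homomorphism rule, applied to the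
    product of a generator and its inverse. *)
Definition fox_letter p a : V :=
  fun g => if a.2 then - p a.1 (g * letter_value x a)%g else p a.1 g.

(* The value at [w] of the crossed homomorphism from the free group to the
   functions on [G] that maps the [i]-th generator to [p i]. *)
Fixpoint fox p w : V :=
  if w is a :: w' then
    fun g => fox_letter p a g + fox p w' (g * letter_value x a)%g
  else 0.

Lemma fox_cons p a w g :
  fox p (word_cons a w) g = fox_letter p a g + fox p w (g * letter_value x a)%g.
Proof.
case: w => [|b w] //=; case: eqP => //= ->.
rewrite letter_value_inv mulgK addrA.
case: a => y [] /=; rewrite /fox_letter /= /letter_value /= ?mulgK ?mulgVK.
  by rewrite addNr add0r.
by rewrite subrr add0r.
Qed.

Lemma fox_mul p u v g :
  fox p (word_mul u v) g = fox p u g + fox p v (g * word_value x u)%g.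
Proof.
elim: u g => [|a u IHu] g /=; first by rewrite mulg1 add0r.
by rewrite fox_cons IHu addrA mulgA.
Qed.

Lemma fox_linear w (k : rat) p q : fox (k *: p + q) w = k *: fox p w + fox q w.
Proof.
elim: w => [|b w IHw] /=; first by rewrite scaler0 addr0.
apply/funext => g; rewrite IHw.
rewrite -[RHS]/(k * (_ + _) + (_ + _)) mulrDr addrACA.
rewrite -[(_ + _ : V) _]/(k * _ + _); congr (_ + _).
rewrite /fox_letter; case: b.2 => //=.
by rewrite -[(_ + _ : 'I_n -> V) _ _]/(k * _ + _) opprD mulrN.
Qed.

Lemma fox0 w : fox 0 w = 0.
Proof.
elim: w => //= a w ->; apply/funext => g.
by rewrite /fox_letter; case: a.2; rewrite ?oppr0 addr0.
Qed.

Lemma fox_equivariant h p w : fox (tuple_ldiff h p) w = ldiff h (fox p w).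
Proof.
apply/funext => g; elim: w g => [|a w IHw] g /=; first by rewrite /ldiff subrr.
rewrite IHw /ldiff /= mulgA opprD addrACA; congr (_ + _).
by rewrite /fox_letter /tuple_ldiff /ldiff; case: a.2 => //; rewrite opprB opprK addrC mulgA.
Qed.

Lemma fox_poly c p w : tuple_poly c p -> polyfun c (fox p w).
Proof.
move=> hp; elim: w => [|a w IHw] /=; first exact: polyfun0.
apply: polyfunD; last exact: (@polyfun_rmul _ c _ (fox p w)).
rewrite /fox_letter; case: a.2; last exact: hp.
by apply: polyfunN; apply: (@polyfun_rmul _ c _ (p a.1)).
Qed.

(** The difference tuple of [f] yields a principal crossed homomorphism: the sum along the word
    telescopes. *)
Lemma fox_rdiff f w g :
  fox (fun i => rdiff (x i) f) w g = f (g * word_value x w)%g - f g.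
Proof.
elim: w g => [|a w IHw] g /=; first by rewrite mulg1 subrr.
rewrite IHw mulgA addrC -addrA; congr (_ + _).
rewrite /fox_letter /letter_value /rdiff; case: a.2.
  by rewrite mulgVK opprB addKr.
by rewrite addKr.
Qed.

(** On words with value 1 the crossed homomorphism is additive, and conjugation only translates the
    result. Hence its zeros among those words form a normal subgroup of the free group. *)
Lemma fox_normal_closure p (A : free_group 'I_n -> Prop) :
  (forall r, A r -> word_value x r = 1%g) ->
  (forall r, A r -> fox p r = 0) ->
  forall w : free_group 'I_n, normal_closure A w -> fox p w = 0.
Proof.
move=> A1 Af; have evM := @free_evalM _ _ x.
pose K (w : free_group 'I_n) := free_eval x w = 1%g /\ fox p w = 0.
have KM u v : K u -> K v -> K (u * v)%g.
  move=> [u1 uf] [v1 vf]; split; first by rewrite free_evalM u1 v1 mulg1.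
  by apply/funext => g; rewrite fox_mul uf vf addr0.
have foxV (u : free_group 'I_n) g :
    fox p (u^-1 : free_group 'I_n)%g g = - fox p u (g * (free_eval x u)^-1)%g.
  have := fox_mul p (u^-1 : free_group 'I_n)%g u g.
  rewrite -[word_mul _ _]/(val (u^-1 * u)%g) mulVg /= => /esym/eqP.
  by rewrite addr_eq0 -[word_value x _]/(free_eval x u^-1)%g (morph_V evM) => /eqP.
have KJ (u g : free_group 'I_n) : K u -> K (u ^ g)%g.
  move=> [u1 uf]; split; first by rewrite (morph_J evM) u1 conj1g.
  apply/funext => h; rewrite !fox_mul uf add0r foxV.
  rewrite -[word_value x _]/(free_eval x g^-1)%g -[word_value x _]/(free_eval x u).
  by rewrite u1 mulg1 (morph_V evM) addNr.
move=> w hw; suff [] : K w by [].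
elim: hw => [_ [r [g [Ar ->]]]|||u _ [u1 uf]].
- by apply: KJ; split; [exact: A1|exact: Af].
- by split; rewrite ?(morph_1 evM).
- by move=> u v _ Ku _ Kv; apply: KM.
split; first by rewrite (morph_V evM) u1 invg1.
by apply/funext => h; rewrite foxV uf oppr0.
Qed.

(** Integration along words: the primitive at [g] is the Fox value at 1 of any word for [g], and the
    hypothesis makes it independent of the word. *)
Lemma fox_integral p : (forall g, exists w, free_eval x w = g) ->
  (forall w : free_group 'I_n, free_eval x w = 1%g -> fox p w = 0) ->
  exists2 f, (forall i, rdiff (x i) f = p i) & f 1%g = 0.
Proof.
move=> /choice [s hs] pw; exists (fun g => fox p (s g) 1%g) => [i|]; last first.
  by rewrite pw.
apply/funext => g; rewrite /rdiff.
pose u := (s g * free_gen i)%g; pose w := s (g * x i)%g.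
have uE : free_eval x u = (g * x i)%g.
  by rewrite free_evalM hs; congr (_ * _)%g; apply: mulg1.
(* [w] and [u] are words for the same element, so they differ by a word with value 1. *)
have -> : fox p w 1%g = fox p u 1%g.
  rewrite -[w](mulVKg u) fox_mul.
  rewrite [fox p (u^-1 * w)%g]pw ?addr0 // free_evalM (morph_V (@free_evalM _ _ x)) uE hs mulVg //.
rewrite fox_mul /= -[word_value x (s g)]/(free_eval x (s g)) hs mul1g addr0.
by rewrite addrAC subrr add0r.
Qed.

End FoxCalculus.

(** * Polynomial functions on a presented group *)

Section PresentedGroup.
Variables (G : groupType) (n : nat) (rels : seq (free_group 'I_n)).
Variable phi : {multiplicative free_group 'I_n -> G}.
Hypothesis pres : is_presentation rels phi.
Notation V := (G -> rat^o).
Notation m := (size rels).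
Let x : 'I_n -> G := fun i => phi (free_gen i).

Lemma presentation_eval w : phi w = free_eval x w.
Proof. by apply: free_group_morphE => u v; apply: gmulfM. Qed.

Definition relator_op (p : 'I_n -> V) : 'I_m -> V :=
  fun j => fox x p (tnth (in_tuple rels) j).

Lemma relator_op_linear : linear relator_op.
Proof. by move=> k p q; apply/funext => j; apply: fox_linear. Qed.

Lemma relator_op_equivariant : equivariant relator_op.
Proof. by move=> h p; apply/funext => j; apply: fox_equivariant. Qed.

Lemma relator_op_poly c p : tuple_poly c p -> tuple_poly c (relator_op p).
Proof. by move=> hp j; apply: fox_poly. Qed.

(** Degree less than 1 is preserved, so constant tuples go to constant tuples, linearly. The
    resulting [X] is the matrix of exponent sums of the generators in the relators. *)
Lemma relator_op_cst : exists X : 'M_(n, m),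
  forall v, relator_op (tuple_cst v) = tuple_cst (v *m X).
Proof.
have /choice [F hF] v : exists v', relator_op (tuple_cst v) = tuple_cst v'.
  by apply/tuple_poly1/relator_op_poly/tuple_poly1; exists v.
have cst_linear k : linear (@tuple_cst G k).
  move=> a u v; apply/funext => i; apply/funext => g.
  by rewrite /tuple_cst mxE mxE.
have linF : linear F.
  move=> a u v; apply/eqP; rewrite -subr_eq0; apply/eqP/(@tuple_cst_eq0 G).
  have [C hC] := linear_pack (cst_linear m).
  rewrite -hC linearB linearP !hC -!hF cst_linear relator_op_linear.
  by rewrite subrr.
have [F' hF'] := linear_pack linF.
by exists (lin1_mx F') => v; rewrite mul_rV_lin1 hF hF'.
Qed.

Lemma relator_op_kernel p : relator_op p = 0 <->
  forall w : free_group 'I_n, free_eval x w = 1%g -> fox x p w = 0.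
Proof.
split=> [p0 w|p0]; last first.
  apply/funext => j; apply: p0; rewrite -presentation_eval.
  apply/(proj2 pres); apply: generated_in; exists (tnth (in_tuple rels) j), 1%g.
  by rewrite conjg1 mem_tnth.
rewrite -presentation_eval => /(proj2 pres); apply: fox_normal_closure => r rr.
  rewrite -[word_value x r]/(free_eval x r) -presentation_eval.
  apply/(proj2 pres); apply: generated_in; exists r, 1%g.
  by rewrite conjg1.
have /tnthP [j rE] : r \in in_tuple rels by [].
by rewrite rE; exact: (congr1 (@^~ j) p0).
Qed.

Lemma presentation_onto g : exists w, free_eval x w = g.
Proof. by have [w wg] := proj1 pres g; exists w; rewrite -presentation_eval. Qed.

Lemma relator_op_rdiff f : relator_op (fun i => rdiff (x i) f) = 0.
Proof.
apply/relator_op_kernel => w w1; apply/funext => g.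
by rewrite fox_rdiff -[word_value x w]/(free_eval x w) w1 mulg1 subrr.
Qed.

(** The extra 1 counts the constants, the kernel of the map to difference tuples; surjectivity of
    this map is integration along words. *)
Lemma dim_polyfunS c z :
  has_dim (fun p : 'I_n -> V => tuple_poly c p /\ relator_op p = 0) z ->
  has_dim (@polyfun G c.+1) z.+1.
Proof.
move=> hz; rewrite -[z.+1]add1n.
have [T hT] : exists T : {linear V -> ('I_n -> V)}, T =1 fun f i => rdiff (x i) f.
  apply: linear_pack => a u v; apply/funext => i; apply/funext => g.
  rewrite /rdiff -[RHS]/(a * (_ - _) + (_ - _)).
  rewrite -![(_ + _ : V) _]/(a * _ + _) mulrBr opprD addrACA //.
apply: (dim_extension (T := T) _ _ hz) => [a u v||f hf|p [hp p0]].
- exact: polyfun_linear.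
- apply: (@dim_line _ _ (fun=> 1)) => [|f].
    by apply/eqP => /(congr1 (@^~ 1%g))/eqP; rewrite oner_eq0.
  split=> [[_ Tf]|[a ->]].
    exists (f 1%g); apply/funext => g; have [w <-] := presentation_onto g.
    rewrite -[RHS]/(f 1%g * 1) mulr1.
    apply/eqP; rewrite -subr_eq0 -[free_eval x w]mul1g -fox_rdiff.
    have -> : (fun i => rdiff (x i) f) = 0 by rewrite -hT.
    by rewrite fox0.
  have -> : a *: (fun=> 1 : rat^o) = (fun=> a) :> V.
    by apply/funext => g; rewrite -[LHS]/(a * 1) mulr1.
  split; first exact: polyfun_cst.
  by rewrite hT; apply/funext => i; apply/funext => g; rewrite /rdiff subrr.
- by rewrite hT; split; [move=> i; exact: (proj1 (polyfunSr _ _) hf)|exact: relator_op_rdiff].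
have [f fp _] := fox_integral presentation_onto (proj1 (relator_op_kernel p) p0).
exists f; last by rewrite hT; apply/funext => i; apply: fp.
(* The tuple [p] gives the differences along generators; the difference along any [h] is a Fox value
   of [p], hence of the same degree. *)
apply/polyfunSr => h; have [w <-] := presentation_onto h.
have -> : rdiff (free_eval x w) f = fox x p w.
  apply/funext => g; rewrite -[RHS]/(fox x p w g).
  have -> : p = fun i => rdiff (x i) f by apply/funext => i; rewrite fp.
  by rewrite fox_rdiff.
exact: fox_poly.
Qed.

Lemma polyfun_finite_dim : exists b z : nat -> nat,
  [/\ forall c, has_dim (@polyfun G c) (b c),
      forall c, has_dim (fun p : 'I_n -> V => tuple_poly c p /\ relator_op p = 0) (z c),
      b 0 = 0%N & forall c, b c.+1 = (z c).+1].
Proof.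
have [E hE] := linear_pack relator_op_linear.
have step c b : has_dim (@polyfun G c) b ->
    exists z, has_dim (fun p : 'I_n -> V => tuple_poly c p /\ relator_op p = 0) z.
  move=> hb; have hEp p : tuple_poly c p -> tuple_poly c (E p).
    by rewrite hE; apply: relator_op_poly.
  have [z hz _] := rank_nullity (dim_power n hb) (dim_power m hb) hEp.
  exists z; rewrite (_ : (fun p => _) = (fun p => tuple_poly c p /\ E p = 0)) //.
  by apply/funext => p; rewrite hE.
have dim0 : has_dim (@polyfun G 0) 0.
  have [F hF] := @linear_pack 'rV_0 V (fun=> 0)
    (fun a u v => esym (etrans (addr0 _) (scaler0 _ a))).
  exists F; split=> [u v _|v]; first exact: rV0_eq.
  by split=> [->|[c ->]]; [exists 0; rewrite hF|rewrite hF].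
have /choice [b hb] c : exists b, has_dim (@polyfun G c) b.
  elim: c => [|c [b hb]]; first by exists 0%N.
  by have [z /dim_polyfunS hz] := step _ _ hb; exists z.+1.
have /choice [z hz] c := step _ _ (hb c).
exists b, z; split=> // [|c]; first exact: dim_unique (hb 0) dim0.
exact: dim_unique (hb c.+1) (dim_polyfunS (hz c)).
Qed.

(** Since [b c.+1 = (z c).+1], the recurrences for [z] become strict inequalities for [b], and
    [d * b 2 < b 3] says that [z 2] is maximal. The bound [m < n] enters as [e2 <= d.-1]. *)
Lemma presentation_dim_recurrence : (m < n)%N -> exists (b : nat -> nat) d,
  [/\ forall c, has_dim (@polyfun G c) (b c), b 0 = 0%N, b 1 = 1%N, b 2 = d.+1
    & (0 < d)%N] /\
  [/\ forall c, (d * b c < b c.+1 + d.-1 * b (c - 1))%N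
    & d * b 2 < b 3 -> forall c, (d * b c < b c.+1 + d.-1 * b (c - 2))%N]%N.
Proof.
move=> lt_mn; have [b [z [hb hz b0 bS]]] := polyfun_finite_dim.
have [E hE] := linear_pack relator_op_linear.
have [X hX] := relator_op_cst.
have b1 : b 1 = 1%N.
  rewrite bS; congr _.+1; apply: (dim_eq0 (hz 0)) => p [hp _].
  by apply/funext => i; apply: hp.
have EE : relator_op = E by apply/funext => p; rewrite hE.
have [||||e1 [e2 [d [m_e n_e z1 rec1 rec2]]]] :=
    @kernel_dim_recurrence G n m X E _ _ _ b z hb _ b1.
- by rewrite -EE; apply: relator_op_equivariant.
- by move=> c p; rewrite -EE; apply: relator_op_poly.
- by move=> v; rewrite -EE.
- by rewrite -EE.
have lt_e2d : (e2 < d)%N by rewrite -(ltn_add2l e1) m_e n_e.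
have le_e2d : (e2 <= d.-1)%N by case: (d) lt_e2d.
exists b, d; split; first by split=> //; [rewrite bS z1|apply: leq_ltn_trans lt_e2d].
split=> [c|z2 c]; rewrite bS addSn ltnS.
  by apply: leq_trans (rec1 c) _; rewrite leq_add2l leq_mul2r le_e2d orbT.
rewrite (bS 2) ltnS in z2; apply: leq_trans (rec2 z2 c) _.
by rewrite leq_add2l leq_mul2r le_e2d orbT.
Qed.

End PresentedGroup.

(** * Growth of the recurrences *)

Section Growth.
Local Open Scope nat_scope.

Lemma exists_exp_gt_poly h : exists e, (2 * e).+1 ^ h < 2 ^ e.
Proof.
(* With [e = 2 ^ k] the left side is at most [2 ^ ((k + 2) * h)], and the exponent [4h^2 + 2h] is
   less than [(j + 1)^2 <= 2 ^ k]. *)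
pose j := (2 * h)%N; pose k := (2 * j)%N; exists (2 ^ k).
have le1 : (2 * 2 ^ k).+1 <= 2 ^ k.+2.
  by rewrite !expnS; have : 0 < 2 ^ k; [rewrite expn_gt0|lia].
have le2 : (2 * 2 ^ k).+1 ^ h <= (2 ^ k.+2) ^ h.
  by case: (h) => // h'; rewrite leq_exp2r.
apply: leq_ltn_trans le2 _.
rewrite -expnM ltn_exp2l // (_ : 2 ^ k = 2 ^ j * 2 ^ j); last by rewrite -expnD /k mul2n addnn.
have lj : j < 2 ^ j by apply: ltn_expl.
apply: leq_trans (leq_mul lj lj); rewrite /k /j; nia.
Qed.

(* The increments of [b] at least double at each step if [2 < d], and dominate
   the Fibonacci numbers if [d = 2] and [6 < b 3]. *)
Lemma recurrence_growth (b : nat -> nat) (d h : nat) :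
  (forall c, b c <= c ^ h) -> b 0 = 0 -> b 1 = 1 -> b 2 = d.+1 ->
  (forall c, d * b c < b c.+1 + d.-1 * b (c - 1)) ->
  (d * b 2 < b 3 -> forall c, d * b c < b c.+1 + d.-1 * b (c - 2)) ->
  d <= 2 /\ (d = 2 -> b 3 <= 6).
Proof.
move=> bh b0 b1 b2 rec1 rec2; have [e he] := exists_exp_gt_poly h.
(* At [c = 2e] such growth gives [b (2e + 1) >= 2 ^ e], above the bound [(2e + 1) ^ h]. The rate
   [2 ^ c./2] serves both cases. *)
have {he} contra : ~ forall c, b c + 2 ^ c./2 <= b c.+1.
  move=> /(_ (2 * e)%N); rewrite mul2n doubleK -mul2n => hb.
  by have := bh (2 * e).+1; lia.
split=> [|d2]; rewrite leqNgt; apply/negP => hd; apply: contra.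
  suff key c : b c + 2 ^ c <= b c.+1.
    move=> c; apply: leq_trans (key c); rewrite leq_add2l leq_exp2l //.
    by rewrite -divn2 leq_div.
  elim: c => [|c IHc]; first by rewrite b0 b1.
  (* The next increment exceeds [d - 1 >= 2] times the current one. *)
  have := rec1 c.+1; rewrite subn1 /= expnS => r; move: IHc r.
  move: (b c) (b c.+1) (b c.+2) (2 ^ c) => u v w t; case: d hd {b2 rec1 rec2} => // d'.
  by rewrite /=; nia.
have {rec2} rec2 : forall c, 2 * b c < b c.+1 + b (c - 2).
  by move=> c; have := rec2 _ c; rewrite d2 mul1n; apply; rewrite b2 d2.
(* By [rec2] each increment exceeds the sum of the two before it, so the lower bound doubles every
   two steps; hence the strong induction. *)
move=> c; have [k] := ubnP c; elim: k c => // k IHk [|[|c]] lt_ck.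
- by rewrite b0 b1.
- by rewrite b1 b2 d2.
have := rec2 c.+2; rewrite !subSS subn0 /= expnS => r.
have := IHk c.+1 lt_ck; have := IHk c (ltnW lt_ck).
have : 2 ^ c./2 <= 2 ^ (uphalf c).
  by rewrite leq_exp2l // uphalf_half leq_addl.
by move: r; rewrite /=; lia.
Qed.

End Growth.

(** * Subgroups and commutators *)

Section Subgroups.
Local Open Scope group_scope.
Variable G : groupType.
Implicit Types (S T A : G -> Prop) (x y z g : G).

Definition subgroup S :=
  [/\ S 1, forall x y, S x -> S y -> S (x * y) & forall x, S x -> S x^-1].
Definition normal_pred S := forall x g, S x -> S (x ^ g).
Definition comm_sub S := generated (fun z => exists x y, S x /\ z = [~ x, y]).

Lemma generated_subgroup A : subgroup (generated A).
Proof.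
by split; [exact: generated_1|exact: generated_M|exact: generated_V].
Qed.

Lemma generated_min A S : subgroup S -> (forall x, A x -> S x) ->
  forall x, generated A x -> S x.
Proof. by move=> [S1 SM SV] AS x; elim=> {x} *; auto. Qed.

Lemma generated_normal A : normal_pred A -> normal_pred (generated A).
Proof.
move=> nA x g; elim=> {x} [x Ax||x y _ Hx _ Hy|x _ Hx].
- by apply: generated_in; apply: nA.
- by rewrite conj1g; apply: generated_1.
- by rewrite conjMg; apply: generated_M.
by rewrite conjVg; apply: generated_V.
Qed.

Lemma normal_closure_normal A : normal_pred (normal_closure A).
Proof.
apply: generated_normal => _ g [a [k [Aa ->]]].
by exists a, (k * g); rewrite conjgM.
Qed.

Lemma comm_sub_normal S : normal_pred S -> normal_pred (comm_sub S).
Proof.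
move=> nS; apply: generated_normal => _ g [x [y [Sx ->]]].
by exists (x ^ g), (y ^ g); rewrite conjRg; split=> //; apply: nS.
Qed.

Lemma comm_subW S T : (forall x, S x -> T x) ->
  forall x, comm_sub S x -> comm_sub T x.
Proof.
move=> ST; apply: generated_min (generated_subgroup _) _ => _ [x [y [Sx ->]]].
by apply: generated_in; exists x, y; split=> //; apply: ST.
Qed.

Lemma comm_sub_sub S : subgroup S -> normal_pred S ->
  forall x, comm_sub S x -> S x.
Proof.
move=> sS nS; apply: generated_min => // _ [x [y [Sx ->]]].
by case: sS => _ SM SV; rewrite commgEl; apply: SM; [apply: SV|apply: nS].
Qed.

Lemma lcs_subgroup c : subgroup (@lower_central_series G c).
Proof. by case: c => [|c]; [split|exact: generated_subgroup]. Qed.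

Lemma lcs_normal c : normal_pred (@lower_central_series G c).
Proof. by elim: c => [|c IHc]; [|exact: comm_sub_normal]. Qed.

Lemma commMl x y z : commute [~ x, z] y -> [~ x * y, z] = [~ x, z] * [~ y, z].
Proof.
move=> xzy; have -> : [~ x * y, z] = [~ x, z] ^ y * [~ y, z].
  by rewrite !commgEl conjMg !conjgE !invgM !mulgA !mulgK.
by rewrite conjgE xzy mulKg.
Qed.

Lemma commMr x y z : commute [~ x, y] z -> [~ x, y * z] = [~ x, z] * [~ x, y].
Proof.
move=> xyz; have -> : [~ x, y * z] = [~ x, z] * [~ x, y] ^ z.
  by rewrite !commgEl !conjgE !invgM !mulgA !mulgK.
by rewrite [_ ^ z]conjgE xyz mulKg.
Qed.

Lemma commVl x z : (forall y, commute [~ x, z] y) -> [~ x^-1, z] = [~ x, z]^-1.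
Proof. by move=> h; apply/esym/mulg1_eq; rewrite -commMl // mulgV comm1g. Qed.

Lemma commVr x y : (forall z, commute [~ x, y] z) -> [~ x, y^-1] = [~ x, y]^-1.
Proof.
move=> h; apply: (mulIg [~ x, y]).
by rewrite -commMr // mulgV mulVg commg1.
Qed.

Lemma commXl x z n : (forall y, commute [~ x, z] y) -> [~ x ^+ n, z] = [~ x, z] ^+ n.
Proof.
by move=> h; elim: n => [|n IHn]; rewrite ?comm1g // !expgS commMl ?IHn.
Qed.

End Subgroups.

(** * Quotients by normal subgroups *)

Section Quotient.
Local Open Scope group_scope.
Variables (G : groupType) (N : G -> Prop).
Hypotheses (sN : subgroup N) (nN : normal_pred N).

Definition same_coset (x y : G) : bool := `[< N (x^-1 * y) >].
(** A canonical element of each coset makes the quotient a subtype of [G], which inherits its choice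
    structure. *)
Definition coset_repr (x : G) : G := choose (same_coset x) x.

Lemma same_coset_refl x : same_coset x x.
Proof. by apply/asboolP; rewrite mulVg; case: sN. Qed.

Lemma same_cosetS x y : same_coset x y = same_coset y x.
Proof.
by apply/asboolP/asboolP; case: sN => _ _ NV /NV; rewrite invgM invgK.
Qed.

Lemma same_coset_trans x y z : same_coset x y -> same_coset x z -> same_coset y z.
Proof.
rewrite same_cosetS => /asboolP yx /asboolP xz; apply/asboolP.
by case: sN => _ NM _; have := NM _ _ yx xz; rewrite mulgA mulgK.
Qed.

Lemma coset_reprP x : same_coset x (coset_repr x).
Proof. exact: chooseP (same_coset_refl x). Qed.

Lemma coset_repr_eq x y : (coset_repr x = coset_repr y) <-> same_coset x y.
Proof.
split=> [e|xy].
  apply: (@same_coset_trans (coset_repr x)); first by rewrite same_cosetS coset_reprP.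
  by rewrite e same_cosetS coset_reprP.
rewrite /coset_repr (@eq_choose _ _ (same_coset y)) => [|z].
  by apply: choose_id; [rewrite same_cosetS|exact: same_coset_refl].
by apply/idP/idP; apply: same_coset_trans => //; rewrite same_cosetS.
Qed.

Lemma coset_reprK x : coset_repr (coset_repr x) = coset_repr x.
Proof. by apply/coset_repr_eq; rewrite same_cosetS coset_reprP. Qed.

Definition quotient_type := {x : G | coset_repr x == x}.
HB.instance Definition _ := Choice.on quotient_type.

Definition quotient_map (x : G) : quotient_type :=
  exist (fun x => coset_repr x == x) (coset_repr x) (introT eqP (coset_reprK x)).

Lemma quotient_map_val u : quotient_map (val u) = u.
Proof. by apply/val_inj => /=; apply/eqP/(valP u). Qed.

Lemma quotient_map_eq x y : quotient_map x = quotient_map y <-> N (x^-1 * y).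
Proof.
split=> [/(congr1 val)/coset_repr_eq/asboolP //|xy].
by apply/val_inj/coset_repr_eq/asboolP.
Qed.

Definition quotient_mul (u v : quotient_type) := quotient_map (val u * val v).
Definition quotient_inv (u : quotient_type) := quotient_map (val u)^-1.

Lemma quotient_mapM x y :
  quotient_map (x * y) = quotient_mul (quotient_map x) (quotient_map y).
Proof.
apply/quotient_map_eq => /=; rewrite invgM -mulgA.
have /asboolP xN := coset_reprP x; have /asboolP yN := coset_reprP y.
move: (coset_repr x) (coset_repr y) xN yN => x' y' xN yN.
case: sN => _ NM _; have := NM _ _ (nN y xN) yN.
by rewrite conjgE !mulgA mulgK.
Qed.

Lemma quotient_mapV x : quotient_map x^-1 = quotient_inv (quotient_map x).
Proof.
apply/quotient_map_eq => /=; have /asboolP := coset_reprP x.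
move: (coset_repr x) => x' xN; rewrite invgK.
case: sN => _ _ NV; have := nN x^-1 (NV _ xN).
by rewrite conjgE !invgM !invgK -!mulgA mulgV mulg1.
Qed.

Lemma quotient_mulA : associative quotient_mul.
Proof.
move=> u v w; rewrite -[u]quotient_map_val -[v]quotient_map_val -[w]quotient_map_val.
by rewrite -!quotient_mapM mulgA.
Qed.
Lemma quotient_mul1 : left_id (quotient_map 1) quotient_mul.
Proof. by move=> u; rewrite -[u]quotient_map_val -!quotient_mapM mul1g. Qed.
Lemma quotient_mulr1 : right_id (quotient_map 1) quotient_mul.
Proof. by move=> u; rewrite -[u]quotient_map_val -!quotient_mapM mulg1. Qed.
Lemma quotient_mulV : left_inverse (quotient_map 1) quotient_inv quotient_mul.
Proof.
by move=> u; rewrite -[u]quotient_map_val -quotient_mapV -!quotient_mapM mulVg.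
Qed.
Lemma quotient_mulrV : right_inverse (quotient_map 1) quotient_inv quotient_mul.
Proof.
by move=> u; rewrite -[u]quotient_map_val -quotient_mapV -!quotient_mapM mulgV.
Qed.

HB.instance Definition _ := isGroup.Build quotient_type
  quotient_mulA quotient_mul1 quotient_mulr1 quotient_mulV quotient_mulrV.

Lemma exists_quotient : exists (Q : groupType) (f : G -> Q),
  [/\ {morph f : x y / x * y}, forall q, exists x, f x = q &
      forall x, f x = 1 <-> N x].
Proof.
exists quotient_type, quotient_map; split.
- exact: quotient_mapM.
- by move=> q; exists (val q); apply: quotient_map_val.
move=> x; rewrite -[1]/(quotient_map 1); split=> [/esym/quotient_map_eq|Nx].
  by rewrite invg1 mul1g.
by apply/esym/quotient_map_eq; rewrite invg1 mul1g.
Qed.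

End Quotient.

(** * Bounded generation of nilpotent groups *)

Section BoundedGeneration.
Local Open Scope group_scope.
Variable G : groupType.
Implicit Types (x y z g : G) (s t : seq G).
Notation lcs := (@lower_central_series G).

Definition box s x := exists es, x = power_product s es.

Lemma box1 s : box s 1.
Proof.
exists [::]; elim: s => //= g s <-; by rewrite expg0 mulg1.
Qed.

Lemma box_cat s t x y : box s x -> box t y -> box (s ++ t) (x * y).
Proof.
move=> [es ->] [fs ->]; elim: s es => [|g s IHs] es /=; first by exists fs; rewrite mul1g.
have [es' e] := IHs (behead es).
by exists (head 0%N es :: es'); rewrite /= -e mulgA.
Qed.

Section Central.
Variables (Q : groupType) (f : G -> Q).
Hypothesis fM : {morph f : x y / x * y}.

(** Exponents of equal factors add up once the factors commute. This is known in [Q], so [z] agrees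
    with the product after applying [f]. *)
Lemma boxM_central s x y : (forall u, u \in s -> forall q, commute (f u) q) ->
  box s x -> box s y -> exists2 z, box s z & f z = f x * f y.
Proof.
move=> cs [es ->] [fs ->]; elim: s cs es fs => [|g s IHs] cs es fs /=.
  by exists 1; [exact: box1|rewrite -fM mulg1].
have [u us|_ [gs ->] fz] := IHs _ (behead es) (behead fs).
  by apply: cs; rewrite inE us orbT.
exists (g ^+ (head 0%N es + head 0%N fs) * power_product s gs).
  by exists ((head 0 es + head 0 fs)%N :: gs).
have cg n q : commute (f (g ^+ n)) q.
  rewrite (morph_X fM); apply/commute_sym/commuteX/commute_sym.
  by apply: cs; rewrite mem_head.
rewrite !fM fz expgnDr fM -!mulgA; congr (_ * _).
by rewrite !mulgA (cg _ (f (power_product s (behead es)))).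
Qed.

Lemma box_mem s x : x \in s -> box s x.
Proof.
case/path.splitPr=> s1 s2; rewrite -{2}[x]mul1g; apply: box_cat; first exact: box1.
by have [es e] := box1 s2; exists (1%N :: es); rewrite /= -e expg1 mulg1.
Qed.

Lemma box_generated_central s x :
  (forall u, u \in s -> forall q, commute (f u) q) ->
  generated (fun y => y \in s) x ->
  exists2 z, box (s ++ [seq u^-1 | u <- s]) z & f z = f x.
Proof.
move=> cs; set s' := s ++ _.
have cs' u : u \in s' -> forall q, commute (f u) q.
  rewrite mem_cat => /orP[/cs //|/mapP[v /cs cv ->] q].
  by rewrite (morph_V fM); apply/commute_sym/commuteV/commute_sym.
(* Both [x] and its inverse are tracked, which makes the inversion step of the induction
   symmetric. *)
suff key : generated (fun y => y \in s) x ->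
    (exists2 z, box s' z & f z = f x) /\ (exists2 z, box s' z & f z = f x^-1).
  by move=> /key [].
elim=> {x} [x xs||x y _ [[a ba fa] [b bb fb]] _ [[c bc fc] [d bd fd]]|x _ [h1 h2]].
- split; [exists x|exists x^-1] => //; apply: box_mem; rewrite mem_cat ?xs //.
  by rewrite (map_f (fun u => u^-1)) ?orbT.
- by rewrite invg1; split; exists 1 => //; apply: box1.
- split; first by have [z bz fz] := boxM_central cs' ba bc; exists z; rewrite // fM -fa -fc.
  have [z bz fz] := boxM_central cs' bd bb; exists z => //.
  by rewrite invgM fM -fd -fb.
by rewrite invgK.
Qed.

End Central.

(** Modulo [lcs c.+2] the commutators [[~ z, g]] with [z] in [lcs c] are central, hence
    multiplicative in both arguments, and they are trivial for [z] in [lcs c.+1]. Commutators of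
    generators therefore suffice. *)
Lemma lcs_step_generated c s t :
  (forall x, generated (fun y => y \in s) x) ->
  (forall u, u \in t -> lcs c u) ->
  (forall z, lcs c z -> exists2 y, generated (fun y => y \in t) y & lcs c.+1 (y^-1 * z)) ->
  let t' := [seq [~ u, g] | u <- t, g <- s] in
  (forall u, u \in t' -> lcs c.+1 u) /\
  forall z, lcs c.+1 z ->
    exists2 y, generated (fun y => y \in t') y & lcs c.+2 (y^-1 * z).
Proof.
move=> hs ht gt t'; split=> [_ /allpairsP [[u g] /= [ut _ ->]]|].
  by apply: generated_in; exists u, g; split=> //; apply: ht.
have [Q [f [fM fonto fker]]] := exists_quotient (lcs_subgroup G c.+2) (@lcs_normal G c.+2).
pose B q := exists2 y, generated (fun y => y \in t') y & f y = q.
have sB : subgroup B.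
  split=> [|_ _ [a ga <-] [b gb <-]|_ [a ga <-]].
  - by exists 1; [exact: generated_1|exact: morph_1].
  - by exists (a * b); [exact: generated_M|exact: fM].
  by exists a^-1; [exact: generated_V|exact: morph_V].
have [B1 BM BV] := sB.
have central w q : lcs c.+1 w -> commute (f w) q.
  move=> cw; have [v <-] := fonto q; apply/commgP/eqP.
  by rewrite -(morph_R fM); apply/fker/generated_in; exists w, v.
have cR y g q : lcs c y -> commute [~ f y, f g] q.
  move=> cy; rewrite -(morph_R fM); apply: central.
  by apply: generated_in; exists y, g.
have step1 u g : u \in t -> B [~ f u, f g].
  move=> ut; have cu := ht _ ut; have cRu k := cR u k ^~ cu.
  elim: (hs g) => {g} [g gs||g h _ Bg _ Bh|g _ Bg].
  - exists [~ u, g]; last exact: morph_R.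
    by apply: generated_in; apply/allpairsP; exists (u, g).
  - by rewrite (morph_1 fM) commg1.
  - by rewrite fM commMr //; apply: BM.
  by rewrite (morph_V fM) commVr //; apply: BV.
have tc y : generated (fun y => y \in t) y -> lcs c y.
  by apply: generated_min => //; apply: lcs_subgroup.
have step2 y g : generated (fun y => y \in t) y -> B [~ f y, f g].
  elim=> {y} [y yt||y z gy By gz Bz|y gy By]; first exact: step1.
  - by rewrite (morph_1 fM) comm1g.
  - by rewrite fM commMl; [apply: BM|apply/cR/tc].
  by rewrite (morph_V fM) commVl; [apply: BV|move=> q; apply/cR/tc].
have step3 z g : lcs c z -> B [~ f z, f g].
  move=> cz; have [y gy cy] := gt z cz.
  rewrite -[z](mulVKg y) fM commMl; last by apply/cR/tc.
  have /eqP -> : [~ f (y^-1 * z), f g] == 1 by apply/commgP/central.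
  by rewrite mulg1; apply: step2.
move=> z cz; have [y gy fy] : B (f z).
  apply: (@generated_min _ _ (fun z => B (f z))) cz; last first.
    by move=> _ [a [b [ca ->]]]; rewrite (morph_R fM); apply: step3.
  split=> [|a b|a]; first by rewrite (morph_1 fM).
    by rewrite fM; apply: BM.
  by rewrite (morph_V fM); apply: BV.
by exists y => //; apply/fker; rewrite fM (morph_V fM) fy mulVg.
Qed.

Lemma nilpotent_bounded_generation :
  finitely_generated G -> nilpotent_group G -> exists s, forall x, box s x.
Proof.
move=> [s hs] [c nilc].
have gens k : exists2 t : seq G, (forall u, u \in t -> lcs k u) &
    forall z, lcs k z ->
      exists2 y, generated (fun y => y \in t) y & lcs k.+1 (y^-1 * z).
  elim: k => [|k [t ht gt]]; last by have [] := lcs_step_generated hs ht gt; eexists; eassumption.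
  exists s => // z _; exists z => //.
  by rewrite mulVg; apply: generated_1.
suff [t ht] : exists t : seq G, forall x, exists2 y, box t y & lcs c (y^-1 * x).
  exists t => x; have [y by_ /nilc] := ht x.
  by move/mulg1_eq; rewrite invgK => <-.
(* A product that is right modulo [lcs c] is corrected by factors central modulo [lcs c.+1], whose
   inverses are listed too because exponents are natural. *)
elim: c {nilc} => [|c [t ht]]; first by exists [::] => x; exists 1 => //; apply: box1.
have [u hu gu] := gens c.
exists (t ++ (u ++ [seq v^-1 | v <- u])) => x; have [y bty cy] := ht x.
have [w gw cw] := gu _ cy.
have [Q [f [fM fonto fker]]] := exists_quotient (lcs_subgroup G c.+1) (@lcs_normal G c.+1).
have [v' q|v bv fv] := box_generated_central fM _ gw.
  move=> q'; have [v <-] := fonto q'; apply/commgP/eqP.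
  by rewrite -(morph_R fM); apply/fker/generated_in; exists v', v; split=> //; apply: hu.
exists (y * v); first exact: box_cat.
apply/fker; rewrite fM (morph_V fM) fM fv invgM -mulgA -(morph_V fM y) -fM.
by rewrite -(morph_V fM) -fM; apply/fker.
Qed.

End BoundedGeneration.

(** * An invariant homomorphism to the rationals *)

Section InvariantHomomorphism.
Local Open Scope group_scope.
Variable G : groupType.
Hypotheses (tfG : torsion_free G) (nilG : nilpotent_group G).
Variable N : G -> Prop.
Hypotheses (sN : subgroup N) (nN : normal_pred N).

Let Ni i := iter i (@comm_sub G) N.

Let Ni_subgroup i : subgroup (Ni i).
Proof. by case: i => //= i; apply: generated_subgroup. Qed.

Let Ni_normal i : normal_pred (Ni i).
Proof. by elim: i => //= i; apply: comm_sub_normal. Qed.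

(** Modulo the next term, [[~ x, y] ^+ k = [~ x ^+ k, y]], so torsion of one factor of the series
    passes to the following one. *)
Lemma central_series_torsion :
  (forall z, N z -> exists2 k, (0 < k)%N & comm_sub N (z ^+ k)) ->
  forall i z, Ni i z -> exists2 k, (0 < k)%N & Ni i.+1 (z ^+ k).
Proof.
move=> torN; elim=> // i IHi z Nz.
have [Q [f [fM fonto fker]]] := exists_quotient (Ni_subgroup i.+2) (@Ni_normal i.+2).
have central w q : Ni i.+1 w -> commute (f w) q.
  move=> Nw; have [v <-] := fonto q; apply/commgP/eqP.
  by rewrite -(morph_R fM); apply/fker/generated_in; exists w, v.
suff [_ [k k0 fz]] : Ni i.+1 z /\ exists2 k, (0 < k)%N & f z ^+ k = 1.
  by exists k => //; apply/fker; rewrite (morph_X fM).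
have [N1 NM NV] := Ni_subgroup i.+1.
apply: (@generated_min _ _ (fun z => Ni i.+1 z /\ exists2 k, (0 < k)%N & f z ^+ k = 1)) Nz.
  split=> [|x y [Nx [k k0 fx]] [Ny [l l0 fy]]|x [Nx [k k0 fx]]].
  - by split=> //; exists 1%N => //; rewrite (morph_1 fM).
  - split; first exact: NM.
    exists (k * l)%N; first by rewrite muln_gt0 k0.
    rewrite fM expgMn; last exact: central.
    by rewrite expgnA fx expg1n mul1g mulnC expgnA fy expg1n.
  split; first exact: NV.
  by exists k => //; rewrite (morph_V fM) expVgn fx invg1.
move=> _ [x [y [Nx ->]]]; have Nxy : Ni i.+1 [~ x, y].
  by apply: generated_in; exists x, y.
split=> //; have [k k0 Nxk] := IHi _ Nx; exists k => //.
rewrite (morph_R fM) -commXl -?(morph_R fM); last by move=> q; apply: central.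
by rewrite -(morph_X fM) -(morph_R fM); apply/fker/generated_in; exists (x ^+ k), y.
Qed.

(** Otherwise every term of the central series contains a positive power of [x]; by nilpotency one
    of these powers is 1, against torsion-freeness. *)
Lemma exists_infinite_order : (exists2 x, N x & x <> 1) ->
  exists2 z, N z & forall k, (0 < k)%N -> ~ comm_sub N (z ^+ k).
Proof.
move=> [x Nx x1]; apply: contrapT => h; apply: x1.
have torN z : N z -> exists2 k, (0 < k)%N & comm_sub N (z ^+ k).
  move=> Nz; apply: contrapT => h'; apply: h; exists z => // k k0 Mzk.
  by apply: h'; exists k.
have NiL i y : Ni i y -> lower_central_series i y.
  by elim: i y => // i IHi; apply: comm_subW.
have tor i : exists2 k, (0 < k)%N & Ni i (x ^+ k).
  elim: i => [|i [k k0 Nk]]; first by exists 1%N.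
  have [l l0 Nl] := central_series_torsion torN Nk.
  by exists (k * l)%N; rewrite ?muln_gt0 ?k0 // expgnA.
have [c nilc] := nilG; have [k k0 /NiL /nilc] := tor c.
exact: tfG.
Qed.

(** Zorn's lemma. Maximality will give [N / H] rank one: any larger subgroup of [N] contains a
    positive power of [z]. *)
Lemma exists_maximal_isolating z :
  (forall k, (0 < k)%N -> ~ comm_sub N (z ^+ k)) ->
  exists H : G -> Prop, [/\ subgroup H, forall x, comm_sub N x -> H x,
    forall x, H x -> N x, forall k, (0 < k)%N -> ~ H (z ^+ k) &
    forall H' : G -> Prop, subgroup H' -> (forall x, H x -> H' x) ->
      (forall x, H' x -> N x) -> (forall k, (0 < k)%N -> ~ H' (z ^+ k)) ->
      forall x, H' x -> H x].
Proof.
move=> hz.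
pose good (H : set G) := [/\ subgroup H, forall x, comm_sub N x -> H x,
  forall x, H x -> N x & forall k, (0 < k)%N -> ~ H (z ^+ k)].
pose P (H : set G) := (forall x, ~ H x) \/ good H.
have goodM : good (comm_sub N).
  by split=> //; [exact: generated_subgroup|exact: comm_sub_sub].
have [F FP Ftot|H [PH maxH]] := @Zorn_bigcup G P.
  have [[X FX gX]|nog] := pselect (exists2 X, F X & good X); last first.
    left=> x [X FX Xx]; have [/(_ x) //|gX] := FP X FX.
    by apply: nog; exists X.
  have gF Y y : F Y -> Y y -> good Y.
    by move=> FY Yy; have [/(_ y)|] := FP Y FY.
  have [[X1 XM XV] MX XN Xz] := gX.
  right; split=> [|x Mx|x [Y FY Yx]|k k0 [Y FY Yz]].
  - split=> [|x y [Y FY Yx] [Z FZ Zy]|x [Y FY Yx]]; first by exists X.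
    + have [YZ|ZY] := Ftot Y Z FY FZ.
        exists Z => //; have [[_ ZM _] _ _ _] := gF _ _ FZ Zy.
        by apply: ZM => //; apply: YZ.
      exists Y => //; have [[_ YM _] _ _ _] := gF _ _ FY Yx.
      by apply: YM => //; apply: ZY.
    by exists Y => //; have [[_ _ YV] _ _ _] := gF _ _ FY Yx; apply: YV.
  - by exists X => //; apply: MX.
  - by have [_ _ YN _] := gF _ _ FY Yx; apply: YN.
  by have [_ _ _ /(_ k k0)] := gF _ _ FY Yz.
have [H0|[sH MH HN Hz]] := PH.
  case: (maxH (comm_sub N)); last by right.
  split=> [x /H0 //|h]; apply: (H0 1); apply: h; exact: generated_1.
exists H; split=> // H' sH' HH' H'N H'z x H'x; apply: contrapT => nHx.
apply: (maxH H'); last by right; split=> // y /MH /HH'.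
by split=> [y /HH' //|/(_ x H'x)].
Qed.

(* On [N / H], with [H] as in [exists_maximal_isolating], every element has a
   power in the infinite cyclic group generated by [z]: this embeds [N / H]
   in the rationals. *)
Lemma exists_invariant_hom : (exists2 x, N x & x <> 1) ->
  exists theta : G -> rat,
    [/\ exists2 z, N z & theta z = 1%R,
        forall x y, N x -> N y -> theta (x * y) = (theta x + theta y)%R &
        forall x g, N x -> theta (x ^ g) = theta x].
Proof.
move=> /exists_infinite_order [z Nz hz].
have [H [sH MH HN Hz maxH]] := exists_maximal_isolating hz.
have [N1 NM NV] := sN; have [H1 HM HV] := sH.
have nH : normal_pred H.
  move=> x g Hx; rewrite -[x ^ g](mulVKg x) -commgEl.
  by apply: HM => //; apply/MH/generated_in; exists x, g; split=> //; apply: HN.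
have [Q [f [fM fonto fker]]] := exists_quotient sH nH.
have central w q : N w -> commute (f w) q.
  move=> Nw; have [v <-] := fonto q; apply/commgP/eqP.
  by rewrite -(morph_R fM); apply/fker/MH/generated_in; exists w, v.
have fJ x g : N x -> f (x ^ g) = f x.
  by move=> Nx; rewrite (morph_J fM) conjgE central // mulKg.
pose Z := f z.
have ZX_neq1 k : (0 < k)%N -> Z ^+ k <> 1.
  by move=> k0 Zk; apply: (Hz k k0); apply/fker; rewrite (morph_X fM).
have ZX_inj a b : Z ^+ a = Z ^+ b -> a = b.
  wlog le_ab : a b / (a <= b)%N.
    by move=> h ab; have [/h ->//|/ltnW /h h'] := leqP a b; rewrite h'.
  move=> ab; apply/eqP; rewrite eqn_leq le_ab leqNgt -subn_gt0; apply/negP => lt_ab.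
  by apply: (ZX_neq1 _ lt_ab); rewrite expgnFr // ab mulgV.
(* [q] measures [x] in units of [z]; the two exponents [a] and [b] avoid negative powers. *)
pose R x (q : rat) := exists k a b, [/\ (0 < k)%N, f x ^+ k * Z ^+ a = Z ^+ b &
  q = ((b%:R - a%:R) / k%:R)%R].
have Zc q a : commute (Z ^+ a) q.
  by apply/commute_sym/commuteX/commute_sym/central.
have Rex x : N x -> exists q, R x q.
  move=> Nx.
  have fxc q a : commute (f x ^+ a) q by apply/commute_sym/commuteX/commute_sym/central.
  (* [H'] is the preimage in [N] of the cyclic group generated by [f x]. By maximality it contains a
     positive power of [z], or else [x] lies in [H]. *)
  pose H' y := N y /\ exists e d, f y * f x ^+ e = f x ^+ d.
  have sH' : subgroup H'.
    split=> [|u v [Nu [e [d ud]]] [Nv [e' [d' vd]]]|u [Nu [e [d ud]]]].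
    - by split=> //; exists 0%N, 0%N; rewrite (morph_1 fM) mulg1.
    - split; first exact: NM.
      exists (e + e')%N, (d + d')%N.
      by rewrite fM !expgnDr -ud -vd -!mulgA; congr (_ * _); rewrite !mulgA fxc.
    split; first exact: NV.
    by exists d, e; rewrite -ud (morph_V fM) mulKg.
  have HH' y : H y -> H' y.
    by move=> Hy; split; [exact: HN|exists 0%N, 0%N; rewrite mulg1; apply/fker].
  have [[k k0 H'zk]|noz] := pselect (exists2 k, (0 < k)%N & H' (z ^+ k)).
    have [_ [e [d]]] := H'zk; rewrite (morph_X fM) -/Z => ed.
    have [lt_ed|lt_de|eq_ed] := ltngtP e d.
    - exists ((k%:R - 0%:R) / (d - e)%:R)%R, (d - e)%N, 0%N, k.
      split=> //; first by rewrite subn_gt0.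
      by rewrite mulg1 expgnFr ?(ltnW lt_ed) // -ed mulgK.
    - exists ((0%:R - k%:R) / (e - d)%:R)%R, (e - d)%N, k, 0%N.
      split=> //; first by rewrite subn_gt0.
      rewrite expgnFr ?(ltnW lt_de) // -ed invgM mulgA mulgV mul1g.
      exact: mulVg.
    case: (ZX_neq1 k k0); apply: (mulIg (f x ^+ e)).
    by rewrite ed eq_ed mul1g.
  have Hx : H x.
    apply: (maxH H') => //; first by move=> y [].
      by move=> k k0 H'zk; apply: noz; exists k.
    by split=> //; exists 0%N, 1%N; rewrite mulg1 expg1.
  exists ((0%:R - 0%:R) / 1%:R)%R, 1%N, 0%N, 0%N; split=> //.
  by rewrite mulg1 expg1; apply/fker.
have Rfun x q q' : N x -> R x q -> R x q' -> q = q'.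
  move=> Nx [k [a [b [k0 xk ->]]]] [k' [a' [b' [k'0 xk' ->]]]].
  have fxc e p : commute (f x ^+ e) p by apply/commute_sym/commuteX/commute_sym/central.
  have e1 : f x ^+ (k * k') * Z ^+ (a * k') = Z ^+ (b * k').
    by rewrite !expgnA -expgMn // xk.
  have e2 : f x ^+ (k * k') * Z ^+ (a' * k) = Z ^+ (b' * k).
    by rewrite mulnC !expgnA -expgMn // xk'.
  have : Z ^+ (b * k' + a' * k) = Z ^+ (b' * k + a * k').
    by rewrite !expgnDr -e1 -e2 -!mulgA; congr (_ * _); apply: Zc.
  move=> /ZX_inj /(congr1 (fun n => n%:R : rat)); rewrite !natrD !natrM => ee.
  apply/eqP; rewrite GRing.eqr_div ?Num.Theory.pnatr_eq0 -?lt0n //; apply/eqP.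
  rewrite !mulrBl; apply/eqP; rewrite subr_eq addrAC -subr_eq opprK.
  by rewrite ee.
have RM : forall x y q q', N x -> N y -> R x q -> R y q' -> R (x * y) (q + q')%R.
  move=> x y q q' Nx Ny [k [a [b [k0 xk ->]]]] [k' [a' [b' [k'0 yk ->]]]].
  exists (k * k')%N, (a * k' + a' * k)%N, (b * k' + b' * k)%N; split.
  - by rewrite muln_gt0 k0.
  - rewrite fM expgMn; last exact: central.
    rewrite !expgnDr !expgnA -xk -yk -!expgnA expgMn; last first.
      by apply/commute_sym; apply: Zc.
    rewrite expgMn; last by apply/commute_sym; apply: Zc.
    rewrite -!expgnA [(k' * k)%N]mulnC -!mulgA; congr (_ * _).
    by rewrite !mulgA; congr (_ * _); apply/commute_sym/Zc.
  rewrite !natrD !natrM addf_div ?Num.Theory.pnatr_eq0 -?lt0n //; congr (_ / _)%R.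
  by rewrite !mulrBl opprD addrACA.
pose theta x := if pselect (exists q, R x q) is left h then projT1 (cid h) else 0%R.
have thetaP x : N x -> R x (theta x).
  move=> Nx; rewrite /theta; case: pselect => [h|[]]; last exact: Rex.
  by case: cid.
exists theta; split.
- exists z => //; apply: (Rfun z) => //; first exact: thetaP.
  by exists 1%N, 0%N, 1%N; rewrite mulg1 subr0 divr1.
- move=> x y Nx Ny; apply: (Rfun (x * y)); [exact: NM|exact/thetaP/NM|].
  by apply: RM => //; exact: thetaP.
move=> x g Nx; apply: (Rfun x) => //; last exact: thetaP.
have [k [a [b [k0 xk q]]]] := thetaP _ (nN g Nx).
by exists k, a, b; split=> //; rewrite -(fJ x g).
Qed.

End InvariantHomomorphism.

(** * Integer powers *)

Section IntegerPowers.
Local Open Scope group_scope.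
Variable G : groupType.
Implicit Types (x g : G) (a b : int).

Definition zpow x (a : int) : G :=
  match a with Posz n => x ^+ n | Negz n => x ^- n.+1 end.

Lemma zpowS x a : zpow x (a + 1)%R = zpow x a * x.
Proof.
case: a => [n|[|n]].
- by rewrite (_ : (n%:Z + 1)%R = n.+1%:Z); [rewrite /= expgSr|lia].
- by rewrite /= expg1 mulVg.
rewrite (_ : (Negz n.+1 + 1)%R = Negz n); last lia.
by rewrite /= [in RHS]expgS invgM mulgVK.
Qed.

Lemma zpowB1 x a : zpow x (a - 1)%R = zpow x a * x^-1.
Proof. by rewrite -[in RHS](subrK 1%R a) zpowS mulgK. Qed.

Lemma zpowD x a b : zpow x (a + b)%R = zpow x a * zpow x b.
Proof.
elim: b => [|n IHn|n IHn]; first by rewrite addr0 mulg1.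
  by rewrite intS [(1 + _)%R]addrC addrA !zpowS IHn mulgA.
by rewrite intS [(1 + _)%R]addrC opprD addrA !zpowB1 IHn mulgA.
Qed.

Lemma morph_zpow (H : groupType) (f : G -> H) (fM : {morph f : x y / x * y}) x a :
  f (zpow x a) = match a with Posz n => f x ^+ n | Negz n => f x ^- n.+1 end.
Proof. by case: a => n; rewrite /zpow ?(morph_V fM) (morph_X fM). Qed.

Lemma commute_zpow x g a b : commute x g -> commute (zpow x a) (zpow g b).
Proof.
move=> xg; suff h c : commute x (zpow g c).
  by case: a => n /=; apply/commute_sym; [|apply: commuteV]; apply/commuteX/commute_sym.
by case: c => n /=; [|apply: commuteV]; apply: commuteX.
Qed.

End IntegerPowers.

(** * Additive functions and their images *)

Section AdditiveFunctions.
Variable G : groupType.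

Definition additive_map (V : zmodType) (a : G -> V) :=
  forall g h, a (g * h)%g = a g + a h.

Section Rules.
Variables (V : zmodType) (a : G -> V).
Hypothesis aM : additive_map a.

Lemma additive_map1 : a 1%g = 0.
Proof. by apply: (addrI (a 1%g)); rewrite -aM mulg1 addr0. Qed.

Lemma additive_mapV g : a (g^-1)%g = - a g.
Proof. by apply: (addIr (a g)); rewrite -aM mulVg addNr additive_map1. Qed.

Lemma additive_mapJ g h : a (g ^ h)%g = a g.
Proof. by rewrite conjgE !aM additive_mapV addrCA addNr addr0. Qed.

Lemma additive_map_zpow g k : a (zpow g k) = a g *~ k.
Proof.
elim: k => [|n IHn|n IHn]; first by rewrite /= additive_map1.
  by rewrite intS [1 + _]addrC zpowS aM IHn mulrzDr.
by rewrite intS [1 + _]addrC opprD zpowB1 aM IHn additive_mapV mulrzDr mulrNz.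
Qed.

End Rules.

Lemma polyfun2_additive (f : G -> rat^o) :
  polyfun 2 f -> additive_map (fun g => f g - f 1%g).
Proof.
move=> hf g h; have /polyfun1 /(congr1 (@^~ h)) : polyfun 1 (ldiff g f) by apply: hf.
rewrite /ldiff mulg1 => /eqP; rewrite subr_eq => /eqP ->.
by rewrite -addrA.
Qed.

(** Up to its value at 1, a function of degree less than 2 is additive. The list [1 :: s] imposes
    [size s + 1] linear conditions, the first of which removes the constants. *)
Lemma exists_additive e (s : seq G) : has_dim (@polyfun G 2) e ->
  ((size s).+1 < e)%N ->
  exists a : G -> rat, [/\ additive_map a, exists g, a g != 0 &
    forall x, x \in s -> a x = 0].
Proof.
move=> he lt_se; apply: contrapT => noa.
have [T hT] : exists T : {linear (G -> rat^o) -> 'rV[rat]_((size s).+1)},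
    T =1 (fun f => \row_i f (nth 1%g (1%g :: s) i)).
  by apply: linear_pack => a u v; apply/rowP => i; rewrite !mxE.
suff : (e <= (size s).+1)%N by rewrite leqNgt lt_se.
apply: (dim_le (T := T) he (dim_full _)) => // f hf Tf0.
have f0 x : x \in 1%g :: s -> f x = 0.
  move=> xs; have lt_x : (index x (1%g :: s) < (size s).+1)%N by rewrite index_mem.
  by have /rowP /(_ (Ordinal lt_x)) := Tf0; rewrite hT !mxE nth_index.
have f1 : f 1%g = 0 by apply: f0; rewrite mem_head.
apply/funext => g; apply: contrapT => /eqP fg; apply: noa.
exists f; split; [|by exists g|by move=> x xs; apply: f0; rewrite inE xs orbT].
by have := polyfun2_additive hf; rewrite f1 => h u v; have := h u v; rewrite !subr0.
Qed.

(** The image is a nonzero finitely generated subgroup of the rationals, hence infinite cyclic; [q]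
    is a generator. *)
Lemma additive_map_cyclic_image (a : G -> rat) :
  finitely_generated G -> additive_map a -> (exists g, a g != 0) ->
  exists (q : rat) (alpha : G -> int) x,
    [/\ forall g, a g = q * (alpha g)%:~R, q != 0, additive_map alpha & alpha x = 1].
Proof.
move=> [s hs] aM [g0 ag0].
have [D D0 hD] : exists2 D : nat, (0 < D)%N &
    forall g, g \in s -> exists k : int, D%:R * a g = k%:~R.
  elim: s {hs} => [|g s [D D0 hD]]; first by exists 1%N.
  exists (`|denq (a g)| * D)%N => [|h]; first by rewrite muln_gt0 absz_gt0 denq_neq0.
  rewrite inE natrM => /orP[/eqP->|/hD [k hk]].
    exists (numq (a g) * D%:Z)%R; rewrite intrM -mulrA mulrCA mulrC; congr (_ * _).
    have -> : (`|denq (a g)|%N%:R : rat) = (denq (a g))%:~R.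
      by rewrite pmulrn absz_denq.
    by rewrite mulrC -{1}[a g]divq_num_den mulfVK // intr_eq0 denq_neq0.
  exists (`|denq (a g)|%N%:Z * k)%R; rewrite -mulrA hk intrM //.
have /choice [al hal] g : exists k : int, D%:R * a g = k%:~R.
  elim: (hs g) => {g} [g||g h _ [k hk] _ [l hl]|g _ [k hk]]; first exact: hD.
  - by exists 0; rewrite additive_map1 // mulr0.
  - by exists (k + l); rewrite aM mulrDr hk hl intrD.
  by exists (- k); rewrite additive_mapV // mulrN hk rmorphN.
have D0r : (D%:R : rat) != 0 by rewrite Num.Theory.pnatr_eq0 -lt0n.
have alM : additive_map al.
  by move=> g h; apply: (@intr_inj rat); rewrite intrD -!hal aM mulrDr.
(* The least positive value of [al] generates its image, since the remainder of any value modulo it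
   is again a value. *)
have exn : exists n, [&& (0 < n)%N & `[< exists g, al g = n%:Z >]].
  have al0 : al g0 != 0.
    apply/eqP => al0; have := hal g0; rewrite al0 => /eqP.
    by rewrite mulf_eq0 (negPf ag0) (negPf D0r).
  case E : (al g0) al0 => [n|n] // n0.
    by exists n; rewrite lt0n n0; apply/asboolP; exists g0.
  by exists n.+1; apply/asboolP; exists (g0^-1)%g; rewrite additive_mapV // E.
case: (ex_minnP exn) => n /andP[n0 /asboolP [x alx]] nmin.
have n0z : n%:Z != 0 by rewrite -lt0n.
have dvd g : al g = n%:Z * (al g %/ n%:Z)%Z.
  have := divz_eq (al g) n%:Z; have := modz_ge0 (al g) n0z.
  have : (al g %% n%:Z < n%:Z)%Z by apply: ltz_pmod.
  case E : (al g %% n%:Z)%Z => [[|r]|r] // lt_rn _; first by rewrite addr0 mulrC.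
  move=> ag; rewrite ltz_nat ltnNge in lt_rn; case/negP: lt_rn; apply: nmin => /=.
  apply/asboolP; exists (g * zpow x (- (al g %/ n%:Z)%Z))%g.
  rewrite alM additive_map_zpow // alx {1}ag mulrNz -mulrzr intz.
  by rewrite [_ * n%:Z]mulrC addrAC subrr add0r.
exists (n%:R / D%:R), (fun g => (al g %/ n%:Z)%Z), x; split.
- move=> g; apply: (mulfI D0r); rewrite hal {1}dvd intrM mulrA; congr (_ * _).
  by rewrite mulrCA divff // mulr1.
- by rewrite mulf_neq0 ?invr_eq0 // Num.Theory.pnatr_eq0 -lt0n.
- move=> g h; apply: (mulfI n0z); rewrite mulrDr -!dvd; exact: alM.
by rewrite alx divzz n0z.
Qed.

End AdditiveFunctions.

(** * Extending the homomorphism to a quadratic function *)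

Section QuadraticFunction.
Variables (G : groupType) (alpha beta : G -> int) (x y : G) (theta : G -> rat).
Hypotheses (alphaM : additive_map alpha) (betaM : additive_map beta).
Hypotheses (alpha_x : alpha x = 1) (beta_x : beta x = 0) (alpha_y : alpha y = 0).
(** This form covers both uses: [beta = 0] in rank one and [beta y = 1] in rank two. *)
Hypothesis beta_y : forall g, beta g * beta y = beta g.

Definition common_kernel (g : G) := alpha g = 0 /\ beta g = 0.
Local Notation N := common_kernel.
Hypothesis thetaM : forall g h, N g -> N h -> theta (g * h)%g = theta g + theta h.
Hypothesis thetaJ : forall g h, N g -> theta (g ^ h)%g = theta g.

Lemma common_kernel_subgroup : subgroup N.
Proof.
split=> [|g h [ag bg] [ah bh]|g [ag bg]].
- by split; apply: additive_map1.
- by split; [rewrite alphaM ag ah|rewrite betaM bg bh].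
by split; rewrite additive_mapV // (ag, bg) oppr0.
Qed.

Lemma common_kernel_normal : normal_pred N.
Proof. by move=> g h [ag bg]; split; rewrite additive_mapJ. Qed.

Let theta1 : theta 1%g = 0.
Proof.
have [N1 _ _] := common_kernel_subgroup.
by apply: (addrI (theta 1%g)); rewrite -thetaM // mulg1 addr0.
Qed.

(* [g] is its [kernel_part] times the normal form [torus_section] of its image;
   the failure of [kernel_part] to be a morphism is a [torus_commutator]. *)
Definition torus_section a b := (zpow x a * zpow y b)%g.
Local Notation u := torus_section.
Definition kernel_part g := (g * (u (alpha g) (beta g))^-1)%g.
Definition torus_commutator b a :=
  (zpow y b * zpow x a * (zpow y b)^-1 * (zpow x a)^-1)%g.

Lemma kernel_partP g : N (kernel_part g).
Proof.
split; rewrite /kernel_part /u.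
  rewrite alphaM additive_mapV // alphaM !additive_map_zpow // alpha_x alpha_y.
  by rewrite mul0rz addr0 intz subrr.
rewrite betaM additive_mapV // betaM !additive_map_zpow // beta_x mul0rz add0r.
by rewrite -mulrzr intz mulrC beta_y subrr.
Qed.

Lemma torus_commutatorP b a : N (torus_commutator b a).
Proof.
split; rewrite /torus_commutator.
  by rewrite !alphaM !(additive_mapV alphaM) addrAC addrK subrr.
by rewrite !betaM !(additive_mapV betaM) addrAC addrK subrr.
Qed.

(** A commutator is multiplicative in one argument up to conjugation, which [theta] ignores. *)
Lemma torus_commutator_additive b a a' :
  theta (torus_commutator b (a + a')) =
  theta (torus_commutator b a) + theta (torus_commutator b a').
Proof.
have -> : torus_commutator b (a + a') =
    (torus_commutator b a * torus_commutator b a' ^ (zpow x a)^-1)%g.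
  rewrite /torus_commutator zpowD conjgE !invgK !invgM !mulgA.
  by rewrite !(mulgVK, mulgK).
rewrite thetaM ?thetaJ //; try exact: torus_commutatorP.
by apply: common_kernel_normal; apply: torus_commutatorP.
Qed.

(** Merging the two normal forms conjugates the kernel part of [g], invisibly to [theta], and
    interchanges a power of [y] with a power of [x], which leaves the commutator. *)
Lemma kernel_partM h g : theta (kernel_part (h * g)%g) =
  theta (kernel_part h) + theta (kernel_part g)
  + theta (torus_commutator (beta h) (alpha g)).
Proof.
have [_ NM _] := common_kernel_subgroup.
have nN := common_kernel_normal.
have [Nh Ng] := (kernel_partP h, kernel_partP g).
have Nt := torus_commutatorP (beta h) (alpha g).
have -> : kernel_part (h * g) = (kernel_part h
    * (kernel_part g ^ (u (alpha h) (beta h))^-1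
    * torus_commutator (beta h) (alpha g) ^ (zpow x (alpha h))^-1))%g.
  rewrite /kernel_part /torus_commutator /u alphaM betaM !zpowD !conjgE.
  by rewrite !invgM !invgK !mulgA !(mulgVK, mulgK).
rewrite thetaM //; last exact: NM (nN _ _ Ng) (nN _ _ Nt).
by rewrite (thetaM (nN _ _ Ng) (nN _ _ Nt)) !thetaJ // addrA.
Qed.

Definition kernel_coord : G -> rat^o := fun g => theta (kernel_part g).

Lemma kernel_coordE g : N g -> kernel_coord g = theta g.
Proof.
by move=> [ag bg]; rewrite /kernel_coord /kernel_part ag bg /u mulg1 invg1 mulg1.
Qed.

Lemma kernel_coord1 : kernel_coord 1%g = 0.
Proof. by rewrite kernel_coordE ?theta1 //; case: common_kernel_subgroup. Qed.

(** The difference along [h] is a constant plus an additive function of [g], hence of degree less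
    than 2. *)
Lemma kernel_coord_poly : polyfun 3 kernel_coord.
Proof.
move=> h; have -> : ldiff h kernel_coord
    = (fun=> kernel_coord h) + (fun g => theta (torus_commutator (beta h) (alpha g))).
  apply/funext => g; rewrite /ldiff /kernel_coord kernel_partM -[RHS]/(_ + _).
  by rewrite addrAC addrK.
apply: polyfunD; first exact: (@polyfun_cst _ 1).
by apply: polyfun_additive => g k; rewrite alphaM torus_commutator_additive.
Qed.

Lemma kernel_coord_additive : (forall g, beta g = 0) -> additive_map kernel_coord.
Proof.
move=> b0 h g; rewrite /kernel_coord kernel_partM b0 /torus_commutator mul1g.
by rewrite invg1 mulg1 mulgV theta1 addr0.
Qed.

Lemma int_additive_polyfun (a : G -> int) : additive_map a ->
  additive_map (fun g => (a g)%:~R : rat).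
Proof. by move=> aM g h; rewrite aM intrD. Qed.

Variable z : G.
Hypotheses (Nz : N z) (theta_z : theta z = 1).

(** The functions 1, [alpha] and [kernel_coord] are independent, as the points 1, [x] and [z]
    show. *)
Lemma polyfun2_dim_ge3 e : (forall g, beta g = 0) ->
  has_dim (@polyfun G 2) e -> (3 <= e)%N.
Proof.
move=> b0 he; pose A g : rat := (alpha g)%:~R.
pose o k (h : (k < 3)%N) : 'I_3 := Ordinal h.
have [F hF] : exists F : {linear 'rV[rat]_3 -> (G -> rat^o)}, F =1 (fun c g =>
    c 0 (@o 0 isT) + c 0 (@o 1 isT) * A g + c 0 (@o 2 isT) * kernel_coord g).
  apply: linear_pack => k u v; apply/funext => g; rewrite !mxE.
  by rewrite -[RHS]/(k * (_ + _ + _) + (_ + _ + _)); lra.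
apply: (dim_ge_free he (phi := F)) => [c|c c0].
  have -> : F c = (fun=> c 0 (@o 0 isT)) + c 0 (@o 1 isT) *: (A : G -> rat^o)
      + c 0 (@o 2 isT) *: kernel_coord by rewrite hF.
  apply: polyfunD; [apply: polyfunD|]; first exact: (@polyfun_cst _ 1).
    by apply: polyfunZ; apply: polyfun_additive; apply: int_additive_polyfun.
  by apply: polyfunZ; apply: polyfun_additive; apply: kernel_coord_additive.
have ev g : F c g = 0 by rewrite c0.
have fz := kernel_coordE Nz; rewrite theta_z in fz.
have := ev 1%g; have := ev z; have := ev x.
rewrite !hF /A kernel_coord1 fz (additive_map1 alphaM) alpha_x (proj1 Nz).
move=> e1 e2 e3.
have h3 : c 0 (@o 0 isT) = 0 by lra.
have h1 : c 0 (@o 2 isT) = 0 by lra.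
rewrite h1 in e1; have h2 : c 0 (@o 1 isT) = 0 by lra.
apply/rowP => -[[|[|[|i]]] hi] //; rewrite mxE.
- by rewrite -[RHS]h3; congr (c 0 _); apply/val_inj.
- by rewrite -[RHS]h2; congr (c 0 _); apply/val_inj.
by rewrite -[RHS]h1; congr (c 0 _); apply/val_inj.
Qed.

(** Besides the six monomials of degree at most 2 in [alpha] and [beta] there is [kernel_coord],
    which is 1 at [z], where the nonconstant monomials vanish. *)
Lemma polyfun3_dim_ge7 e : beta y = 1 ->
  has_dim (@polyfun G 3) e -> (7 <= e)%N.
Proof.
move=> by1 he; pose A g : rat := (alpha g)%:~R; pose B g : rat := (beta g)%:~R.
have AM : additive_map A by apply: int_additive_polyfun.
have BM : additive_map B by apply: int_additive_polyfun.
pose o k (h : (k < 7)%N) : 'I_7 := Ordinal h.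
have [F hF] : exists F : {linear 'rV[rat]_7 -> (G -> rat^o)}, F =1 (fun c g =>
    c 0 (@o 0 isT) + c 0 (@o 1 isT) * A g + c 0 (@o 2 isT) * B g
    + c 0 (@o 3 isT) * (A g * A g) + c 0 (@o 4 isT) * (A g * B g)
    + c 0 (@o 5 isT) * (B g * B g) + c 0 (@o 6 isT) * kernel_coord g).
  apply: linear_pack => k u v; apply/funext => g; rewrite !mxE.
  rewrite -[RHS]/(k * (_ + _ + _ + _ + _ + _ + _) + (_ + _ + _ + _ + _ + _ + _)).
  by lra.
have P2 (a : G -> rat) : additive_map a -> polyfun 2 (a : G -> rat^o).
  exact: polyfun_additive.
have PM (a a' : G -> rat) : additive_map a -> additive_map a' ->
    polyfun 3 (fun g => a g * a' g : rat^o).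
  by move=> aM a'M; apply: polyfunM_additive => //; apply: P2.
apply: (dim_ge_free he (phi := F)) => [c|c c0].
  have -> : F c = (fun=> c 0 (@o 0 isT)) + c 0 (@o 1 isT) *: (A : G -> rat^o)
      + c 0 (@o 2 isT) *: (B : G -> rat^o)
      + c 0 (@o 3 isT) *: (fun g => A g * A g : rat^o)
      + c 0 (@o 4 isT) *: (fun g => A g * B g : rat^o)
      + c 0 (@o 5 isT) *: (fun g => B g * B g : rat^o)
      + c 0 (@o 6 isT) *: kernel_coord by rewrite hF.
  do 6?apply: polyfunD; try apply: polyfunZ; try exact: PM; try exact/polyfunS/P2.
    exact: (@polyfun_cst _ 2).
  exact: kernel_coord_poly.
have ev g : F c g = 0 by rewrite c0.
have [A1 B1] := (additive_map1 AM, additive_map1 BM).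
have [Ax Bx] : A x = 1 /\ B x = 0 by rewrite /A /B alpha_x beta_x.
have [Ay By] : A y = 0 /\ B y = 1 by rewrite /A /B alpha_y by1.
have [Az Bz] : A z = 0 /\ B z = 0 by rewrite /A /B (proj1 Nz) (proj2 Nz).
have fz := kernel_coordE Nz; rewrite theta_z in fz.
have := (ev 1%g); have := ev z; have := ev x; have := ev (x^-1)%g; have := ev y.
have := ev (y^-1)%g; have := ev (x * y)%g.
rewrite !hF !(additive_mapV AM) !(additive_mapV BM) !AM !BM A1 B1 Ax Bx Ay By Az Bz fz kernel_coord1.
move=> e1 e2 e3 e4 e5 e6 e7.
(* The points 1 and [z] settle the first and last coefficients; then the values of [kernel_coord] at
   the other five points drop out. *)
have h0 : c 0 (@o 0 isT) = 0 by lra.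
have h6 : c 0 (@o 6 isT) = 0 by lra.
rewrite h0 h6 in e1 e2 e3 e4 e5.
have h1 : c 0 (@o 1 isT) = 0 by lra.
have h2 : c 0 (@o 2 isT) = 0 by lra.
have h3 : c 0 (@o 3 isT) = 0 by lra.
have h5 : c 0 (@o 5 isT) = 0 by lra.
have h4 : c 0 (@o 4 isT) = 0 by lra.
apply/rowP => -[i hi]; rewrite mxE.
case: i hi => [|[|[|[|[|[|[|i]]]]]]] hi //.
- by rewrite -[RHS]h0; congr (c 0 _); apply/val_inj.
- by rewrite -[RHS]h1; congr (c 0 _); apply/val_inj.
- by rewrite -[RHS]h2; congr (c 0 _); apply/val_inj.
- by rewrite -[RHS]h3; congr (c 0 _); apply/val_inj.
- by rewrite -[RHS]h4; congr (c 0 _); apply/val_inj.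
- by rewrite -[RHS]h5; congr (c 0 _); apply/val_inj.
by rewrite -[RHS]h6; congr (c 0 _); apply/val_inj.
Qed.

End QuadraticFunction.

(** * Recognizing Z and Z^2 *)

Section Isomorphisms.
Variable G : groupType.

Lemma morph_pack (H K : groupType) (f : H -> K) :
  {morph f : x y / (x * y)%g} -> exists F : {multiplicative H -> K}, F =1 f.
Proof.
move=> fM; pose L := isMultiplicative.Build H K f fM.
pose F : {multiplicative H -> K} := HB.pack f L.
by exists F.
Qed.

Lemma isomorphic_pack (H K : groupType) (f : H -> K) :
  {morph f : x y / (x * y)%g} -> (forall x, f x = 1%g -> x = 1%g) ->
  (forall y, exists x, f x = y) -> isomorphic H K.
Proof.
move=> fM f1 fonto; have [F hF] := morph_pack fM; exists F.
have /choice [g gK] := fonto.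
have fK : cancel g F by move=> y; rewrite hF gK.
exists g => // x; apply/divg1_eq/f1.
by rewrite fM (morph_V fM) gK hF mulgV.
Qed.

Lemma isomorphic_Z (alpha : G -> int) x : additive_map alpha ->
  (forall g, alpha g = 0 -> g = 1%g) -> alpha x = 1 -> isomorphic G Zgroup.
Proof.
move=> aM a1 ax; apply: (isomorphic_pack (f := alpha : G -> Zgroup)) => // k.
by exists (zpow x k); rewrite additive_map_zpow // ax intz.
Qed.

Lemma isomorphic_Z2 (alpha beta : G -> int) x y :
  additive_map alpha -> additive_map beta ->
  (forall g, alpha g = 0 -> beta g = 0 -> g = 1%g) ->
  alpha x = 1 -> beta x = 0 -> alpha y = 0 -> beta y = 1 ->
  isomorphic G (Zgroup * Zgroup)%type.
Proof.
move=> aM bM ab1 ax bx ay by1.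
apply: (isomorphic_pack (f := fun g => (alpha g, beta g) : Zgroup * Zgroup)).
- by move=> g h; rewrite aM bM.
- by move=> g [ag bg]; apply: ab1.
move=> [k l]; exists (zpow x k * zpow y l)%g; congr (_, _).
  by rewrite aM !additive_map_zpow // ax ay mul0rz addr0 intz.
by rewrite bM !additive_map_zpow // bx by1 mul0rz add0r intz.
Qed.

Lemma Z_of_isomorphic : isomorphic G Zgroup ->
  exists (alpha : G -> int) x, [/\ additive_map alpha, injective alpha & alpha x = 1].
Proof.
move=> [f [f' fK f'K]]; exists (f : G -> int), (f' (1%R : int)); split.
- by move=> g h; apply: (@gmulfM _ _ f g h).
- exact: can_inj fK.
exact: f'K.
Qed.

Lemma Z2_of_isomorphic : isomorphic G (Zgroup * Zgroup)%type ->
  exists (alpha beta : G -> int) x y,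
    [/\ additive_map alpha, additive_map beta,
        forall g h, alpha g = alpha h -> beta g = beta h -> g = h,
        (alpha x = 1 /\ beta x = 0) & (alpha y = 0 /\ beta y = 1)].
Proof.
move=> [f [f' fK f'K]].
exists (fun g => (f g).1 : int), (fun g => (f g).2 : int),
  (f' (1%R : int, 0%R : int)), (f' (0%R : int, 1%R : int)); split.
- by move=> g h; rewrite (@gmulfM _ _ f g h).
- by move=> g h; rewrite (@gmulfM _ _ f g h).
- move=> g h e1 e2; apply: (can_inj fK).
  by case: (f g) (f h) e1 e2 => [? ?] [? ?] /= -> ->.
- by rewrite f'K.
by rewrite f'K.
Qed.

End Isomorphisms.

(** * Presentations of Z and Z^2 *)

Section PresentationsOfAbelianGroups.
Local Open Scope group_scope.
Variable G : groupType.

Lemma normal_closure_min (H K : groupType) (f : H -> K) (A : H -> Prop) :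
  {morph f : x y / x * y} -> (forall r, A r -> f r = 1) ->
  forall w, normal_closure A w -> f w = 1.
Proof.
move=> fM fA; apply: generated_min.
  split=> [|u v fu fv|u fu]; first exact: morph_1.
    by rewrite fM fu fv mulg1.
  by rewrite (morph_V fM) fu invg1.
by move=> _ [r [g [/fA fr ->]]]; rewrite (morph_J fM) fr conj1g.
Qed.

Lemma free_eval_presentation n (x : 'I_n -> G) (rels : seq (free_group 'I_n)) :
  (size rels < n)%N -> (forall g, exists w, free_eval x w = g) ->
  (forall r, r \in rels -> free_eval x r = 1) ->
  (forall w : free_group 'I_n, free_eval x w = 1 -> normal_closure (fun r => r \in rels) w) ->
  positive_deficiency G.
Proof.
move=> lt_rn onto rel ker; have evM := @free_evalM _ _ x.
have [phi hphi] := morph_pack evM.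
exists n, rels, phi; split=> //; split=> [g|w].
  by have [w <-] := onto g; exists w.
by rewrite hphi; split=> [|]; [exact: ker|exact: normal_closure_min].
Qed.

Lemma free_eval_gen n (x : 'I_n -> G) i : free_eval x (free_gen i) = x i.
Proof. exact: mulg1. Qed.

Lemma free_letter_zpow (X : choiceType) (a : X * bool) :
  free_letter a = zpow (free_gen a.1) (if a.2 then (-1)%R else 1%R).
Proof. by rewrite free_letterE; case: a => y []. Qed.

Lemma positive_deficiency_Z : isomorphic G Zgroup -> positive_deficiency G.
Proof.
move=> /Z_of_isomorphic [al [x [alM al_inj alx]]].
have zpowE w : exists k, w = zpow (free_gen (ord0 : 'I_1)) k.
  elim/free_group_ind: w => [|a w [k ->]]; first by exists 0%R.
  by rewrite free_letter_zpow ord1 -zpowD; eexists.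
pose xs (_ : 'I_1) := x.
have evM := @free_evalM _ _ xs.
have al_ev k : al (free_eval xs (zpow (free_gen ord0) k)) = k.
  by rewrite (morph_zpow evM) free_eval_gen additive_map_zpow // alx intz.
apply: (@free_eval_presentation 1 xs [::]) => // [g|w w1].
  exists (zpow (free_gen ord0) (al g)).
  by apply: al_inj; rewrite al_ev.
have [k wE] := zpowE w; have := al_ev k.
rewrite -wE w1 (additive_map1 alM) => k0.
by rewrite wE -k0; apply: generated_1.
Qed.

(** Two generators and their commutator as the one relator: modulo its normal closure each word is a
    product of a power of [X] and a power of [Y], whose exponents [al] and [be] detect. *)
Lemma positive_deficiency_Z2 :
  isomorphic G (Zgroup * Zgroup)%type -> positive_deficiency G.
Proof.
move=> /Z2_of_isomorphic [al [be [x [y [alM beM inj [alx bex] [aly bey]]]]]].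
pose xs (i : 'I_2) := if i == ord0 then x else y.
pose X : free_group 'I_2 := free_gen ord0; pose Y : free_group 'I_2 := free_gen ord_max.
have evM := @free_evalM _ _ xs.
have evX : free_eval xs X = x by rewrite free_eval_gen.
have evY : free_eval xs Y = y by rewrite free_eval_gen.
pose R (r : free_group 'I_2) := r \in [:: [~ X, Y]].
have ev_ab a b : free_eval xs (zpow X a * zpow Y b) = zpow x a * zpow y b.
  by rewrite evM !(morph_zpow evM) evX evY.
have al_ab a b : al (zpow x a * zpow y b) = a.
  by rewrite alM !additive_map_zpow // alx aly mul0rz addr0 intz.
have be_ab a b : be (zpow x a * zpow y b) = b.
  by rewrite beM !additive_map_zpow // bex bey mul0rz add0r intz.
have evR r : R r -> free_eval xs r = 1.
  rewrite /R inE => /eqP ->; rewrite (morph_R evM) evX evY; apply/eqP/commgP.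
  by apply: inj; rewrite ?alM ?beM addrC.
have [Q [f [fM fonto fker]]] := exists_quotient (generated_subgroup _) (@normal_closure_normal _ R).
have cXY : commute (f X) (f Y).
  apply/commgP/eqP; rewrite -(morph_R fM); apply/fker/generated_in.
  by exists [~ X, Y], 1; rewrite conjg1 /R inE.
have normal_form w : exists a b, f w = f (zpow X a * zpow Y b).
  elim/free_group_ind: w => [|[i e] w [a [b fw]]]; first by exists 0%R, 0%R; rewrite mulg1.
  rewrite fM fw free_letter_zpow /=; set k := (if e then _ else _).
  have [->|->] : i = ord0 \/ i = ord_max.
    by case: i => [[|[|i]]] hi //; [left|right]; apply/val_inj.
    by exists (k + a)%R, b; rewrite -fM mulgA -zpowD.
  exists a, (k + b)%R; rewrite zpowD !fM !mulgA; congr (_ * _).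
  by rewrite !(morph_zpow fM); apply/commute_sym/commute_zpow.
apply: (@free_eval_presentation 2 xs [:: [~ X, Y]]) => // [g|w w1].
  exists (zpow X (al g) * zpow Y (be g)); rewrite ev_ab.
  by apply: inj; rewrite ?al_ab ?be_ab.
have [a [b fw]] := normal_form w; apply/fker; rewrite fw.
(* [w] differs from its normal form by an element of the normal closure, so both have the same value
   in [G]. *)
have : free_eval xs (w^-1 * (zpow X a * zpow Y b)) = 1.
  apply: (normal_closure_min evM evR); apply/fker.
  by rewrite fM (morph_V fM) fw mulVg.
rewrite evM (morph_V evM) w1 invg1 mul1g ev_ab => ab1.
have := al_ab a b; have := be_ab a b; rewrite ab1 !additive_map1 // => <- <-.
by rewrite mulg1; apply: morph_1.
Qed.

End PresentationsOfAbelianGroups.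

(** * Positive deficiency forces Z or Z^2 *)

Section PositiveDeficiency.
Variable G : groupType.
Hypotheses (tfG : torsion_free G) (fgG : finitely_generated G).
Hypothesis nilG : nilpotent_group G.

Lemma positive_deficiency_abelian : positive_deficiency G ->
  isomorphic G Zgroup \/ isomorphic G (Zgroup * Zgroup)%type.
Proof.
move=> [n [rels [phi [pres lt_mn]]]].
have [b [d [[hb b0 b1 b2 d0] [rec1 rec2]]]] := presentation_dim_recurrence pres lt_mn.
have [s hs] := nilpotent_bounded_generation fgG nilG.
have [d2 b3] := recurrence_growth (fun c => polyfun_dim_bound hs (hb c)) b0 b1 b2 rec1 rec2.
have [|a [aM anz _]] := exists_additive (s := [::]) (hb 2); first by rewrite b2 ltnS.
have [q [al [x [_ _ alM alx]]]] := additive_map_cyclic_image fgG aM anz.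
(* Stated for both ranks: [be] is zero if [d = 1], and the second coordinate if [d = 2]. *)
have kernel_trivial (be : G -> int) y : additive_map be -> be x = 0 -> al y = 0 ->
    (forall g, be g * be y = be g) ->
    ((forall g, be g = 0) /\ d = 1%N \/ be y = 1 /\ d = 2) ->
    forall g, al g = 0 -> be g = 0 -> g = 1%g.
  move=> beM bex aly bey cases g ag bg; apply: contrapT => g1.
  have sN := common_kernel_subgroup alM beM; have nN := common_kernel_normal alM beM.
  have [|th [[z Nz thz] thM thJ]] := exists_invariant_hom tfG nilG sN nN; first by exists g.
  case: cases => [[be0 d1]|[be1 dd]].
    have := polyfun2_dim_ge3 alM beM alx bex aly bey thM thJ Nz thz be0 (hb 2).
    by rewrite b2 d1.
  have := polyfun3_dim_ge7 alM beM alx bex aly bey thM thJ Nz thz be1 (hb 3).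
  by move=> /leq_trans /(_ (b3 dd)).
have [d1|dd] : d = 1%N \/ d = 2 by lia.
  left; apply: (isomorphic_Z alM _ alx) => g ag.
  by apply: (kernel_trivial (fun=> 0) 1%g) => //; [exact: additive_map1|left].
(* [b 2 = 3] exceeds the two conditions imposed, one for the constants and one for [x]. *)
right; have [|c [cM cnz cx]] := exists_additive (s := [:: x]) (hb 2); first by rewrite b2 dd.
have [p [be [y0 [cE p0 beM bey0]]]] := additive_map_cyclic_image fgG cM cnz.
have bex : be x = 0.
  have /eqP := cE x; rewrite cx ?mem_head // eq_sym mulf_eq0 (negPf p0) intr_eq0 /=.
  by move/eqP.
(* A power of [x] corrects [y0] so that [al y = 0], and leaves [be] unchanged since [be x = 0]. *)
pose y := (y0 * zpow x (- al y0))%g.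
have aly : al y = 0 by rewrite alM additive_map_zpow // alx intz subrr.
have bey : be y = 1 by rewrite beM additive_map_zpow // bex mul0rz addr0.
apply: (isomorphic_Z2 alM beM _ alx bex aly bey).
by apply: (kernel_trivial be y) => // [g|]; [rewrite bey mulr1|right].
Qed.

End PositiveDeficiency.

Theorem theorem1p4 (G : groupType) (tfG : torsion_free G)
    (fgG : finitely_generated G) (nilG : nilpotent_group G) :
  positive_deficiency G <->
    isomorphic G Zgroup \/ isomorphic G (Zgroup * Zgroup)%type.
Proof.
split=> [|[]]; first exact: positive_deficiency_abelian.
  exact: positive_deficiency_Z.
exact: positive_deficiency_Z2.
Qed.
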